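(* In the setting described in the context, suppose that $\eta<\vartheta$, that $\mathbf c=\langle C^i_n:n<\omega,i<2\rangle\in\mathfrak M$ is an $\mathbf{MT}(\vec P)$-real name, and that for every $k<\omega$ the set $D(k)=\{\tau\in\mathbf{MT}(\vec P):\tau\text{ directly forces }\mathbf c\neq\boldsymbol\pi_{\eta k}\}$ is dense in $\mathbf{MT}(\vec P)$. Let $\nu\in\mathbf{MT}(\vec P\vee\vec U)$ and $U\in U_\eta$. Then there is a multitree $\nu'\in\mathbf{MT}(\vec U)$ with $\nu'\le\nu$ which directly forces $\mathbf c\notin[U]$.
   Context: $2^{<\omega}$ finite binary strings; a tree is a subset of $2^{<\omega}$ closed under initial segments; $\mathbf{PT}$ the nonempty perfect trees; $\mathrm{stem}(T)$ the largest string comparable with all elements of $T$; $T\upharpoonright s=\{t\in T:s\subseteq t\lor t\subseteq s\}$; $[T]=\{a\in2^\omega:\forall n\,a\upharpoonright n\in T\}$. A perfect-tree forcing notion is $P\subseteq\mathbf{PT}$ with $T\upharpoonright u\in P$ whenever $u\in T\in P$. A finite splitting system over $P$ is $\varphi=\langle T_s:s\in 2^{<n}\rangle$ with $T_s\in P$ and, for $s^\frown i\in 2^{<n}$, $T_{s^\frown i}\subseteq T_s$ and $\mathrm{stem}(T_s)^\frown i\subseteq\mathrm{stem}(T_{s^\frown i})$; $\psi\preceq\varphi$ means $\varphi$ extends $\psi$. Multitrees: for $\vec Q=\langle Q_\xi:\xi<\vartheta\rangle$ perfect-tree forcing notions, a $\vec Q$-multitree is $\tau=\langle T_{\xi k}:\xi<\vartheta,k<\omega\rangle$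 with each $T_{\xi k}\in Q_\xi$ or $=2^{<\omega}$, finite support $|\tau|=\{\langle\xi,k\rangle:T_{\xi k}\neq2^{<\omega}\}$; $\mathbf{MT}(\vec Q)$ is the set of them ordered componentwise by $\subseteq$; $[\tau]=\{x\in(2^\omega)^{\vartheta\times\omega}:\forall\langle\xi,k\rangle\in|\tau|\ x(\xi,k)\in[\tau(\xi,k)]\}$. $\vec P\vee\vec Q=\langle P_\xi\cup Q_\xi\rangle_\xi$. Real names: an $\mathbf{MT}(\vec P)$-real name is $\mathbf c=\langle C^i_n:n<\omega,i<2\rangle$ with $C^i_n\subseteq\mathbf{MT}(\vec P)$, each $C^0_n\cup C^1_n$ pre-dense in $\mathbf{MT}(\vec P)$, and every element of $C^0_n$ incompatible with every element of $C^1_n$. For $\xi<\vartheta,k<\omega$, $\boldsymbol\pi_{\xi k}$ is the name with $C^i_n=\{\rho^{\xi k}_{ni}\}$, where $\rho^{\xi k}_{ni}$ has support $\{\langle\xi,k\rangle\}$ and $\rho^{\xi k}_{ni}(\xi,k)=\{s\in2^{<\omega}:|s|>n\Rightarrow s(n)=i\}$. A multitree $\tau$ directly forces $\mathbf c(n)=i$ iff there is a finite $\Sigma\subseteq C^i_n$ with $[\tau]\subseteq\bigcup_{\sigma\in\Sigma}[\sigma]$; directly forces $s\subset\mathbf c$ ($s\in2^{<\omega}$) iff it directly forces $\mathbf c(n)=s(n)$ for all $n<|s|$; directly forces $\mathbf d\neq\mathbf c$ iff there are $\subseteq$-incomparable $s,t$ such that it directly forces $s\subset\mathbf c$ and $t\subset\mathbf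 d$; directly forces $\mathbf c\notin[T]$ iff for some $s\in2^{<\omega}\setminus T$ it directly forces $s\subset\mathbf c$. Setting: ZFC$'$ is ZFC minus Power Set plus ''$\mathcal P(\omega)$ exists''; $\mathfrak M$ a countable transitive model of ZFC$'$; $\vec P=\langle P_\xi:\xi<\vartheta\rangle\in\mathfrak M$, $\vartheta<\omega_1^{\mathfrak M}$, perfect-tree forcing notions countable in $\mathfrak M$. A $\vec P$-multisystem is $\Phi=\langle\varphi_{\xi m}:\xi<\vartheta,m<\omega\rangle$, each $\varphi_{\xi m}$ a finite splitting system over $P_\xi$, finitely many nonempty, ordered componentwise by $\preceq$. $\langle\Phi^j:j<\omega\rangle$ is a $\preceq$-increasing sequence of $\vec P$-multisystems meeting every dense set of $\vec P$-multisystems belonging to $\mathfrak M$. Then $\bigcup_j\Phi^j(\xi,m)=\langle T^{\xi m}_s:s\in 2^{<\omega}\rangle$ with $T^{\xi m}_s\in P_\xi$; $U^{\xi m}_s=\bigcap_{n\ge|s|}\bigcup_{t\in 2^n,\,s\subseteq t}T^{\xi m}_t$; $U_\xi=\{U^{\xi m}_s:m<\omega,\ s\in 2^{<\omega}\}$; $\vec U=\langle U_\xi:\xi<\vartheta\rangle$. *)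

(* Defs.v *)
From mathcomp Require Import all_boot.
From mathcomp Require Import boolp classical_sets functions cardinality.

Set Implicit Arguments.
Unset Strict Implicit.
Unset Printing Implicit Defensive.

Local Open Scope classical_set_scope.

(** [V] is Aczel's type of well-founded trees modulo extensional equality.
    It is a quotient, so Leibniz equality on [V] is extensional ([V_ext]). *)

Inductive preset : Type := Sup (A : Type) (f : A -> preset).

Fixpoint peq (x y : preset) : Prop :=
  match x, y with
  | Sup A f, Sup B g =>
      (forall a, exists b, peq (f a) (g b)) /\
      (forall b, exists a, peq (f a) (g b))
  end.

Definition V : Type := {C : set preset | exists x, C = peq x}.

Definition vmem (x y : V) : Prop :=
  exists (B : Type) (g : B -> preset) (b : B),
    proj1_sig y (Sup g) /\ proj1_sig x (g b).

Definition elts (y : V) : set V := [set x | vmem x y].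

Definition vclass (p : preset) : V := exist _ (peq p) (ex_intro _ p erefl).

(** The set whose elements are exactly the members of [A].  If there is no
    such set (that is, [A] is a proper class) the value is irrelevant; every
    use below is at a class that is a set, see [setof_range]. *)
Definition setof (A : set V) : V :=
  if pselect (exists x, elts x = A) is left h then projT1 (cid h)
  else vclass (Sup (fun e : Empty_set => match e with end)).

Lemma peq_refl x : peq x x.
Proof. by elim: x => A f IH /=; split=> a; exists a. Qed.

Lemma peq_sym x y : peq x y -> peq y x.
Proof.
elim: x y => A f IH [B g] /= [h1 h2]; split.
- by move=> b; have [a /IH ?] := h2 b; exists a.
- by move=> a; have [b /IH ?] := h1 a; exists b.
Qed.

Lemma peq_trans x y z : peq x y -> peq y z -> peq x z.
Proof.
elim: x y z => A f IH [B g] [C h] /= [h1 h2] [k1 k2]; split.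
- move=> a; have [b hb] := h1 a; have [c hc] := k1 b.
  by exists c; exact: IH hb hc.
- move=> c; have [b hb] := k2 c; have [a ha] := h2 b.
  by exists a; exact: IH ha hb.
Qed.

Lemma vclassP (x : V) : exists p, x = vclass p.
Proof. by case: x => C [p Cp]; exists p; apply: eq_exist. Qed.

Lemma vclass_eq p q : peq p q -> vclass p = vclass q.
Proof.
move=> pq; apply: eq_exist; apply/predeqP => r.
by split; [apply: peq_trans; exact: peq_sym | exact: peq_trans].
Qed.

Lemma vmem_vclass (x : V) A (f : A -> preset) :
  vmem x (vclass (Sup f)) <-> exists a, x = vclass (f a).
Proof.
split=> [[B [g [b [/= [_ h]]]]]|[a ->]]; last first.
  by exists A, f, a; split; exact: peq_refl.
have [p ->] := vclassP x => /= pb; have [a ab] := h b.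
by exists a; apply: vclass_eq; exact: peq_trans pb (peq_sym ab).
Qed.

Lemma V_ext (x y : V) : elts x = elts y -> x = y.
Proof.
have [[A f] ->] := vclassP x; have [[B g] ->] := vclassP y => xy.
have e z : (exists a, z = vclass (f a)) <-> (exists b, z = vclass (g b)).
  by rewrite -!vmem_vclass; exact: (predeqP _ _).1 xy z.
have peqE p q : vclass p = vclass q -> peq p q.
  by move=> /(congr1 (fun z => proj1_sig z q)) /= ->; exact: peq_refl.
apply: vclass_eq; split=> [a|b].
- by have [|b /peqE] := (e (vclass (f a))).1; [exists a | exists b].
- by have [|a /peqE/peq_sym] := (e (vclass (g b))).2; [exists b | exists a].
Qed.

Lemma setofP (A : set V) : (exists x, elts x = A) -> elts (setof A) = A.
Proof. by rewrite /setof; case: pselect => // h _; case: cid. Qed.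

Lemma setof_range (I : Type) (f : I -> V) : elts (setof (range f)) = range f.
Proof.
apply: setofP; have [g gE] := choice (fun i => vclassP (f i)).
exists (vclass (Sup g)); apply/predeqP => x.
split=> [/vmem_vclass[i ->]|[i _ <-]]; first by exists i.
by apply/vmem_vclass; exists i.
Qed.

Definition opair (a b : V) : V :=
  setof [set setof [set a]; setof [set a; b]].

Fixpoint vnat (n : nat) : V :=
  if n is m.+1 then setof (elts (vnat m) `|` [set vnat m]) else setof set0.

Definition code_set {T : Type} (c : T -> V) (A : set T) : V := setof (c @` A).

Definition code_fun {A B : Type} (cA : A -> V) (cB : B -> V) (f : A -> B) : V :=
  setof (range (fun a => opair (cA a) (cB (f a)))).

Definition vtransitive (x : V) : Prop := forall y, vmem y x -> elts y `<=` elts x.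

(** Well-foundedness of membership is automatic in [V]. *)
Definition vordinal (x : V) : Prop :=
  vtransitive x /\ forall y, vmem y x -> vtransitive y.

(** Variables are de Bruijn indices. *)
Inductive formula : Type :=
  | FMem of nat & nat
  | FEq of nat & nat
  | FNot of formula
  | FImp of formula & formula
  | FAll of formula.

Section Theory.
Variables (D : Type) (E : D -> D -> Prop).

Definition scons (x : D) (e : nat -> D) : nat -> D :=
  fun n => if n is m.+1 then e m else x.

Fixpoint holds (e : nat -> D) (phi : formula) : Prop :=
  match phi with
  | FMem i j => E (e i) (e j)
  | FEq i j => e i = e j
  | FNot phi => ~ holds e phi
  | FImp phi psi => holds e phi -> holds e psi
  | FAll phi => forall x, holds (scons x e) phi
  end.

Definition ax_extensionality : Prop :=
  forall x y, (forall z, E z x <-> E z y) -> x = y.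

Definition ax_foundation : Prop :=
  forall x, (exists y, E y x) -> exists2 y, E y x & forall z, E z x -> ~ E z y.

Definition ax_pairing : Prop :=
  forall x y, exists z, forall w, E w z <-> w = x \/ w = y.

Definition ax_union : Prop :=
  forall x, exists u, forall w, E w u <-> exists2 y, E w y & E y x.

Definition inductive_set (w : D) : Prop :=
  (exists2 z, E z w & forall x, ~ E x z) /\
  (forall n, E n w -> exists2 m, E m w & forall x, E x m <-> E x n \/ x = n).

Definition ax_infinity : Prop := exists w, inductive_set w.

Definition is_omega (w : D) : Prop :=
  inductive_set w /\ forall v, inductive_set v -> forall n, E n w -> E n v.

Definition ax_separation : Prop :=
  forall (phi : formula) (e : nat -> D) (a : D),
  exists b, forall x, E x b <-> E x a /\ holds (scons x e) phi.

Definition ax_replacement : Prop :=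
  forall (phi : formula) (e : nat -> D) (a : D),
  (forall x y z, E x a -> holds (scons x (scons y e)) phi ->
     holds (scons x (scons z e)) phi -> y = z) ->
  exists b, forall y,
    E y b <-> exists2 x, E x a & holds (scons x (scons y e)) phi.

Definition ax_choice : Prop :=
  forall x,
  (forall y, E y x -> exists z, E z y) ->
  (forall y y' z, E y x -> E y' x -> E z y -> E z y' -> y = y') ->
  exists s, forall y, E y x -> exists! z, E z y /\ E z s.

Definition ax_power_omega : Prop :=
  exists2 w, is_omega w &
  exists p, forall x, E x p <-> forall n, E n x -> E n w.

(** ZFC minus Power Set plus the existence of P(omega).  Replacement is not
    strengthened to Collection, nor Choice to the well-ordering principle. *)
Definition ZFC' : Prop :=
  [/\ ax_extensionality, ax_foundation, ax_pairing & ax_union] /\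
  [/\ ax_infinity, ax_separation, ax_replacement, ax_choice & ax_power_omega].

End Theory.

Definition countable_transitive_model (M : set V) : Prop :=
  [/\ countable M,
      forall x y, M x -> vmem y x -> M y
    & ZFC' (fun x y : {x : V | M x} => vmem (proj1_sig x) (proj1_sig y))].

Definition countable_in (M : set V) (x : V) : Prop :=
  exists g : {a : V | vmem a x} -> nat,
    injective g /\ M (code_fun (@proj1_sig _ _) vnat g).

(** Membership in omega_1^M, the set of the ordinals countable in [M]. *)
Definition lt_omega1_in (M : set V) (theta : V) : Prop :=
  [/\ M theta, vordinal theta & countable_in M theta].

Definition tree : Type := set (seq bool).

Definition is_tree (T : tree) : Prop :=
  forall s t, prefix s t -> T t -> T s.

Definition perfect_tree (T : tree) : Prop :=
  [/\ is_tree T, T !=set0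
    & forall s, T s -> exists t,
        [/\ prefix s t, T (rcons t false) & T (rcons t true)]].

Definition comparable_str (s t : seq bool) : Prop := prefix s t \/ prefix t s.

Definition is_stem (T : tree) (s : seq bool) : Prop :=
  (forall t, T t -> comparable_str s t) /\
  (forall s', (forall t, T t -> comparable_str s' t) -> prefix s' s).

Definition stem (T : tree) : seq bool := xget [::] [set s | is_stem T s].

Definition restrict_tree (T : tree) (s : seq bool) : tree :=
  [set t | T t /\ comparable_str s t].

Definition body (T : tree) : set (nat -> bool) :=
  [set a | forall n, T (mkseq a n)].

Definition ptforcing (P : set tree) : Prop :=
  P `<=` perfect_tree /\ forall T u, P T -> T u -> P (restrict_tree T u).

(** A system is a partial function on strings, undefined meaning [None]. *)
Definition system : Type := seq bool -> option tree.

Definition splitting_system (P : set tree) (phi : system) : Prop :=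
  [/\ exists n, forall s, isSome (phi s) = (size s < n),
      forall s T, phi s = Some T -> P T
    & forall s i T T', phi s = Some T -> phi (rcons s i) = Some T' ->
        T' `<=` T /\ prefix (rcons (stem T) i) (stem T')].

Definition system_le (psi phi : system) : Prop :=
  forall s T, psi s = Some T -> phi s = Some T.

Definition below (theta : V) : Type := {xi : V | vmem xi theta}.

Definition index (theta : V) : Type := (below theta * nat)%type.

Definition multitree (theta : V) : Type := index theta -> tree.

Definition support theta (tau : multitree theta) : set (index theta) :=
  [set p | tau p <> setT].

Definition MT theta (Q : below theta -> set tree) : set (multitree theta) :=
  [set tau | (forall p, Q p.1 (tau p) \/ tau p = setT) /\
             finite_set (support tau)].

Definition mt_le theta (sigma tau : multitree theta) : Prop :=
  forall p, sigma p `<=` tau p.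

Definition mt_body theta (tau : multitree theta) :
    set (index theta -> nat -> bool) :=
  [set x | forall p, support tau p -> body (tau p) (x p)].

Definition family_join theta (P Q : below theta -> set tree) :
    below theta -> set tree := fun xi => P xi `|` Q xi.

Definition compatible theta (Q : below theta -> set tree)
    (sigma tau : multitree theta) : Prop :=
  exists rho, [/\ MT Q rho, mt_le rho sigma & mt_le rho tau].

Definition mt_predense theta (Q : below theta -> set tree)
    (A : set (multitree theta)) : Prop :=
  forall tau, MT Q tau -> exists2 sigma, A sigma & compatible Q sigma tau.

Definition mt_dense theta (Q : below theta -> set tree)
    (D : set (multitree theta)) : Prop :=
  D `<=` MT Q /\
  forall tau, MT Q tau -> exists2 sigma, D sigma & mt_le sigma tau.

Definition multisystem (theta : V) : Type := index theta -> system.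

Definition MS theta (P : below theta -> set tree) : set (multisystem theta) :=
  [set Phi | (forall p, splitting_system (P p.1) (Phi p)) /\
             finite_set [set p | exists s, isSome (Phi p s)]].

Definition ms_le theta (Psi Phi : multisystem theta) : Prop :=
  forall p, system_le (Psi p) (Phi p).

Definition ms_dense theta (P : below theta -> set tree)
    (D : set (multisystem theta)) : Prop :=
  D `<=` MS P /\
  forall Psi, MS P Psi -> exists2 Phi, D Phi & ms_le Psi Phi.

(** [c (n, i)] is the set C^i_n. *)
Definition rname (theta : V) : Type := nat * bool -> set (multitree theta).

Definition real_name theta (P : below theta -> set tree) (c : rname theta) :
    Prop :=
  [/\ forall n i, c (n, i) `<=` MT P,
      forall n, mt_predense P (c (n, false) `|` c (n, true))
    & forall n sigma tau, c (n, false) sigma -> c (n, true) tau ->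
        ~ compatible P sigma tau].

(** At an index [p <> q] the component is the full tree. *)
Definition rho theta (q : index theta) (n : nat) (i : bool) : multitree theta :=
  fun p => [set s | p = q -> n < size s -> nth false s n = i].

Definition pi_name theta (q : index theta) : rname theta :=
  fun ni => [set rho q ni.1 ni.2].

Definition forces_value theta (tau : multitree theta) (c : rname theta)
    (n : nat) (i : bool) : Prop :=
  exists Sigma : set (multitree theta),
    [/\ finite_set Sigma, Sigma `<=` c (n, i)
      & mt_body tau `<=` \bigcup_(sigma in Sigma) mt_body sigma].

Definition forces_initial theta (tau : multitree theta) (c : rname theta)
    (s : seq bool) : Prop :=
  forall n, n < size s -> forces_value tau c n (nth false s n).

Definition forces_neq theta (tau : multitree theta) (d c : rname theta) :
    Prop :=
  exists s t, [/\ ~ comparable_str s t, forces_initial tau c s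
                & forces_initial tau d t].

Definition forces_notin theta (tau : multitree theta) (c : rname theta)
    (T : tree) : Prop :=
  exists2 s, ~ T s & forces_initial tau c s.

(** The set-theoretic objects that the types above stand for: an object
    belongs to a model [M] when its code does. *)

Definition code_string (s : seq bool) : V :=
  setof [set opair (vnat n) (vnat (nth false s n)) | n in [set n | n < size s]].

Definition code_tree : tree -> V := code_set code_string.

Definition code_index theta (p : index theta) : V :=
  opair (proj1_sig p.1) (vnat p.2).

Definition code_family theta (P : below theta -> set tree) : V :=
  code_fun (@proj1_sig _ _) (code_set code_tree) P.

Definition code_multitree theta (tau : multitree theta) : V :=
  code_fun (@code_index theta) code_tree tau.

Definition code_system (phi : system) : V :=
  setof [set z | exists s T,
           phi s = Some T /\ z = opair (code_string s) (code_tree T)].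

Definition code_multisystem theta (Phi : multisystem theta) : V :=
  code_fun (@code_index theta) code_system Phi.

Definition code_rname theta (c : rname theta) : V :=
  code_fun (fun ni : nat * bool => opair (vnat ni.1) (vnat ni.2))
    (code_set (@code_multitree theta)) c.

Definition generic_sequence (M : set V) theta (P : below theta -> set tree)
    (Phi : nat -> multisystem theta) : Prop :=
  [/\ forall j, MS P (Phi j),
      forall j, ms_le (Phi j) (Phi j.+1)
    & forall D, ms_dense P D -> M (code_set (@code_multisystem theta) D) ->
        exists j, D (Phi j)].

(** For an increasing sequence [Phi] at most one tree [T] occurs as
    [Phi j p s = Some T], so the union is that tree. *)
Definition limit_tree theta (Phi : nat -> multisystem theta)
    (p : index theta) (s : seq bool) : tree :=
  \bigcup_(T in [set T | exists j, Phi j p s = Some T]) T.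

Definition fusion_tree theta (Phi : nat -> multisystem theta)
    (p : index theta) (s : seq bool) : tree :=
  \bigcap_(n in [set n | size s <= n])
    \bigcup_(t in [set t | size t = n /\ prefix s t]) limit_tree Phi p t.

Definition fusion_family theta (Phi : nat -> multisystem theta) :
    below theta -> set tree :=
  fun xi => [set U | exists m s, U = fusion_tree Phi (xi, m) s].

(* Main.v *)
(** Let [U] be a fusion tree of the system [(eta, m0)]. Every node of a level of
    that system can be made the value of a coordinate [(eta, k)] of one and the
    same multitree. By density of the sets [D(k)], for these finitely many [k],
    a smaller multitree [tau] decides a string [s] of [c] that lies in no
    [tau (eta, k)]. Shrinking the nodes to the components of [tau] makes [s]
    avoid the whole level, hence [U]. So the multisystems from whose nodes such
    a [tau], compatible with [nu], can be drawn are dense, and one of the generic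
    [Phi j] is such; replacing the nodes from which [tau] is drawn by the fusion
    trees above them yields [nu'].

    The dense set has to belong to the model, but direct forcing quantifies over
    sets of branches; therefore [c(n) = i] is witnessed instead by one [sigma] in
    [C^i_n] above [tau]. The rest is definable by bounded formulas over sets that
    the model has in the absence of Power Set: multitrees and multisystems are
    finite functions up to a default value, and the sequences of length [n] over
    a set of the model are uniformly definable, so Replacement collects them. *)

From HB Require Import structures.
Require Import Defs.
From mathcomp Require Import all_boot.
From mathcomp Require Import boolp classical_sets functions cardinality.

Set Implicit Arguments.
Unset Strict Implicit.
Unset Printing Implicit Defensive.

Local Open Scope classical_set_scope.

Lemma finite_set_ind (T : Type) (Q : set T -> Prop) :
  Q set0 ->
  (forall A x, finite_set A -> Q A -> Q (x |` A)) ->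
  forall A, finite_set A -> Q A.
Proof.
move=> Q0 QS A; pose T' : eqType := HB.pack T (gen_eqMixin T).
move=> /(@finite_seqP T')[s ->]; elim: s => [|x s IHs].
  by have -> : [set` [::]] = set0 :> set T' by apply/seteqP; split.
rewrite (_ : [set` x :: s] = x |` [set` s] :> set T').
  by apply: QS => //; apply/(@finite_seqP T'); exists s.
apply/predeqP => y; rewrite mksetE in_cons.
by split=> [/orP[/eqP|]|[->|/= ->]]; [left|right|rewrite eqxx|rewrite orbT].
Qed.

Lemma functional_option_fun (A B : Type) (R : A -> B -> Prop) :
  (forall x y z, R x y -> R x z -> y = z) ->
  exists f : A -> option B, forall x y, f x = Some y <-> R x y.
Proof.
move=> R_fun; suff /choice[f fR] x : exists o, forall y, o = Some y <-> R x y.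
  by exists f.
have [[y Rxy]|nR] := pselect (exists y, R x y); last first.
  by exists None => y; split=> // Rxy; case: nR; exists y.
by exists (Some y) => z; split=> [[<-] //|Rxz]; congr Some; exact: R_fun Rxy Rxz.
Qed.

Lemma finite_set_bound (T : Type) (A : set T) (f : T -> nat) :
  finite_set A -> exists n, forall x, A x -> f x < n.
Proof.
move: A; apply: finite_set_ind => [|A x _ [n An]]; first by exists 0.
exists (maxn n (f x).+1) => y [->|/An yn]; first exact: leq_maxr.
exact: leq_trans yn (leq_maxl _ _).
Qed.

(** * Sets and classes *)

Definition is_set (A : set V) : Prop := exists x, elts x = A.

Lemma vmem_setof A x : is_set A -> vmem x (setof A) <-> A x.
Proof. by move=> /setofP AE; rewrite -{2}AE. Qed.

Lemma vmem_ext x y : (forall z, vmem z x <-> vmem z y) -> x = y.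
Proof. by move=> xy; apply: V_ext; apply/predeqP. Qed.

Lemma setof_elts x : setof (elts x) = x.
Proof. by apply: V_ext; apply: setofP; exists x. Qed.

Lemma vmem_ind (Q : V -> Prop) :
  (forall x, (forall y, vmem y x -> Q y) -> Q x) -> forall x, Q x.
Proof.
move=> QI x; have [p ->] := vclassP x; elim: p => A f IH.
by apply: QI => y /vmem_vclass[a ->].
Qed.

Lemma vmem_asym x y : vmem x y -> ~ vmem y x.
Proof. by elim/vmem_ind: x y => x IH y xy yx; exact: (IH _ yx _ yx xy). Qed.

(** [T] is small when it is the image of a type that can index a [preset]. *)
Definition small (T : Type) : Prop :=
  exists (I : Type) (g : I -> T), forall t, exists i, g i = t.

(** For types below the universe of [preset] only. *)
Lemma small_type (T : Type) : small T.
Proof. by exists T, id => t; exists t. Qed.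

Lemma small_prod (T U : Type) : small T -> small U -> small (T * U).
Proof.
move=> [I [g gP]] [J [h hP]]; exists (I * J)%type, (fun p => (g p.1, h p.2)).
by move=> [t u]; have [i <-] := gP t; have [j <-] := hP u; exists (i, j).
Qed.

Lemma small_option (T : Type) : small T -> small (option T).
Proof.
move=> [I [g gP]]; exists (option I), (omap g) => -[t|]; last by exists None.
by have [i <-] := gP t; exists (Some i).
Qed.

Lemma small_fun (T U : Type) : small T -> small U -> small (T -> U).
Proof.
move=> [I [g /choice[s gs]]] [J [h /choice[r hr]]].
exists (I -> J), (fun k t => h (k (s t))) => f; exists (r \o f \o g).
by apply/funext => t; rewrite /= gs hr.
Qed.

Lemma small_range (T : Type) (f : T -> V) : small T -> is_set (range f).
Proof.
move=> [I [g gP]]; exists (setof (range (f \o g))); rewrite setof_range.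
apply/predeqP => x; split=> [[i _ <-]|[t _ <-]]; first by exists (g i).
by have [i <-] := gP t; exists i.
Qed.

Lemma elts_range x : exists (I : Type) (f : I -> V), elts x = range f.
Proof.
have [[I f] ->] := vclassP x; exists I, (fun i => vclass (f i)).
apply/predeqP => y; split=> [/vmem_vclass[i ->]|[i _ <-]]; first by exists i.
by apply/vmem_vclass; exists i.
Qed.

Lemma small_elts x : small {y | vmem y x}.
Proof.
have [I [f fE]] := elts_range x.
have fx i : vmem (f i) x by rewrite -[vmem _ _]/(elts x _) fE; exists i.
exists I, (fun i => exist _ (f i) (fx i)) => -[y yx].
have [i _ fi] : range f y by rewrite -fE.
by exists i; exact: eq_exist.
Qed.

Lemma small_below theta : small (below theta).
Proof. exact: small_elts. Qed.

Lemma small_index theta : small (Defs.index theta).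
Proof. by apply: small_prod (small_type nat); exact: small_elts. Qed.

Lemma small_tree : small tree.
Proof. exact: small_fun (small_type (seq bool)) (small_type Prop). Qed.

Lemma small_multitree theta : small (multitree theta).
Proof. exact: small_fun (small_index theta) small_tree. Qed.

Lemma small_multisystem theta : small (multisystem theta).
Proof.
apply: small_fun (small_index theta) _.
exact: small_fun (small_type (seq bool)) (small_option small_tree).
Qed.

#[local] Hint Resolve small_below small_index small_tree small_multitree : core.
#[local] Hint Resolve small_multisystem small_elts : core.
#[local] Hint Extern 0 (small nat) => exact: small_type : core.
#[local] Hint Extern 0 (small bool) => exact: small_type : core.
#[local] Hint Extern 0 (small (seq bool)) => exact: small_type : core.

Lemma is_set_image x (f : V -> V) : is_set (f @` elts x).
Proof.
have [I [g ->]] := elts_range x; rewrite image_comp.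
by exists (setof (range (f \o g))); exact: setof_range.
Qed.

Lemma is_set_sub x (A : set V) : A `<=` elts x -> is_set A.
Proof.
have [I [f ->]] := elts_range x => Af.
exists (setof (range (fun i : {i | A (f i)} => f (projT1 i)))).
rewrite setof_range; apply/predeqP => y; split=> [[[i Ai] _ <-] //|Ay].
by have [i _ iy] := Af y Ay; rewrite -iy in Ay *; exists (exist _ i Ay).
Qed.

Lemma is_set_sep x (A : set V) : is_set [set y | vmem y x /\ A y].
Proof. by apply: (@is_set_sub x) => y []. Qed.

Lemma is_set_bigcup (T : Type) (F : T -> V) :
  small T -> is_set [set y | exists t, vmem y (F t)].
Proof.
move=> [I [g gP]].
have /choice[R RE] : forall i, exists R : {J : Type & J -> V},
    elts (F (g i)) = range (projT2 R).
  by move=> i; have [J [f fE]] := elts_range (F (g i)); exists (existT _ J f).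
pose member (k : {i & projT1 (R i)}) := projT2 (R (projT1 k)) (projT2 k).
exists (setof (range member)).
rewrite setof_range; apply/predeqP => y; split=> [[[i j] _ <-]|[t yt]].
  by exists (g i); rewrite -[vmem _ _]/(elts _ _) RE; exists j.
have [i it] := gP t; have [j _ jy] : range (projT2 (R i)) y by rewrite -RE it.
by exists (existT _ i j).
Qed.

Lemma is_set2 x y : is_set [set x; y].
Proof.
have := small_range (fun b : bool => if b then x else y) (small_type bool).
by congr is_set; apply/predeqP => z; split=> [[[] _ <-]|[->|->]];
  [left|right|exists true|exists false].
Qed.

Lemma vmem2 z x y : vmem z (setof [set x; y]) <-> z = x \/ z = y.
Proof. exact: vmem_setof (is_set2 x y). Qed.

Lemma vmem1 z x : vmem z (setof [set x]) <-> z = x.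
Proof. by rewrite -(setUid [set x]) vmem2; split=> [[]|]; [| |left]. Qed.

Lemma vmem_image z x f : vmem z (setof [set f y | y in elts x]) <->
  exists2 y, vmem y x & z = f y.
Proof.
by rewrite (vmem_setof _ (is_set_image _ _)); split=> -[y]; exists y.
Qed.

Lemma vmem_sep z x (A : set V) :
  vmem z (setof [set y | vmem y x /\ A y]) <-> vmem z x /\ A z.
Proof. exact: vmem_setof (is_set_sep _ _). Qed.

Definition vunion (x : V) : V := setof [set w | exists2 y, vmem y x & vmem w y].

Lemma vmem_vunion w x : vmem w (vunion x) <-> exists2 y, vmem y x & vmem w y.
Proof.
apply: vmem_setof.
have := is_set_bigcup (@proj1_sig V (vmem^~ x)) (small_elts x).
congr is_set; apply/predeqP => z.
split=> [[[y yx] zy]|[y yx zy]]; first by exists y.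
by exists (exist _ y yx).
Qed.

Definition vcup (x y : V) : V := vunion (setof [set x; y]).

Lemma vmem_vcup z x y : vmem z (vcup x y) <-> vmem z x \/ vmem z y.
Proof.
rewrite vmem_vunion; split=> [[w /vmem2[]-> zw]|[zx|zy]]; [by left|by right| |].
  by exists x => //; apply/vmem2; left.
by exists y => //; apply/vmem2; right.
Qed.

Definition vsub (x y : V) : Prop := forall z, vmem z x -> vmem z y.

Lemma vsub_anti x y : vsub x y -> vsub y x -> x = y.
Proof. by move=> xy yx; apply: vmem_ext => z; split; [exact: xy|exact: yx]. Qed.

Lemma setof2_inj a b c d : setof [set a; b] = setof [set c; d] ->
  a = c /\ b = d \/ a = d /\ b = c.
Proof.
move=> e.
have cd z : z = a \/ z = b <-> z = c \/ z = d by rewrite -!vmem2 e.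
have a_cd := (cd a).1 (or_introl erefl).
have b_cd := (cd b).1 (or_intror erefl).
have c_ab := (cd c).2 (or_introl erefl).
have d_ab := (cd d).2 (or_intror erefl).
by case: a_cd b_cd c_ab d_ab => ? [] ? [] ? [] ?; subst; auto.
Qed.

Lemma opair_inj a b c d : opair a b = opair c d -> a = c /\ b = d.
Proof.
have single x : setof [set x] = setof [set x; x] by rewrite setUid.
rewrite /opair !single.
by move=> /setof2_inj[] [/setof2_inj[] [? ?] /setof2_inj[] [? ?]]; subst.
Qed.

Definition vsucc (x : V) : V := vcup x (setof [set x]).

Lemma vmem_vsucc x y : vmem x (vsucc y) <-> vmem x y \/ x = y.
Proof. by rewrite vmem_vcup vmem1. Qed.

Lemma vmem_vnat0 x : ~ vmem x (vnat 0).
Proof. by rewrite /= vmem_setof //; apply: (@is_set_sub (vnat 0)). Qed.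

Lemma vnatS n : vnat n.+1 = vsucc (vnat n).
Proof.
apply: vmem_ext => x; rewrite vmem_vsucc /=; apply: vmem_setof.
exists (vsucc (vnat n)); apply/predeqP => z; exact: vmem_vsucc.
Qed.

Lemma vmem_vnat x n : vmem x (vnat n) <-> exists2 m, m < n & x = vnat m.
Proof.
elim: n => [|n IH]; first by split=> [/vmem_vnat0|[]].
rewrite vnatS vmem_vsucc IH; split=> [[[m mn ->]|->]|[m + ->]].
- by exists m => //; exact: ltnW.
- by exists n.
- by rewrite ltnS leq_eqVlt => /orP[/eqP ->|mn]; [right|left; exists m].
Qed.

Lemma vnat_inj : injective vnat.
Proof.
have neq m n : m < n -> vnat m <> vnat n.
  move=> mn e; have mem : vmem (vnat m) (vnat n) by apply/vmem_vnat; exists m.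
  by apply: (vmem_asym mem); rewrite -{1}e {2}e.
by move=> m n e; case: (ltngtP m n) => // /neq; [|move/nesym]; move/(_ e).
Qed.

Definition vomega : V := setof (range vnat).

Lemma vmem_vomega x : vmem x vomega <-> exists n, x = vnat n.
Proof.
rewrite (vmem_setof _ (small_range _ (small_type _))).
by split=> [[n _ <-]|[n ->]]; exists n.
Qed.

Lemma vmem_vbool x : vmem x (vnat 2) <-> exists b : bool, x = vnat b.
Proof.
rewrite vmem_vnat; split=> [[m m2 ->]|[b ->]]; last by exists b => //; case: b.
by exists (m == 1); case: m m2 => [|[]].
Qed.

(** * Definability over a transitive model *)

Fixpoint rename_formula (f : nat -> nat) (phi : formula) : formula :=
  match phi with
  | FMem i j => FMem (f i) (f j)
  | FEq i j => FEq (f i) (f j)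
  | FNot phi => FNot (rename_formula f phi)
  | FImp phi psi => FImp (rename_formula f phi) (rename_formula f psi)
  | FAll phi =>
      FAll (rename_formula (fun n => if n is m.+1 then (f m).+1 else 0) phi)
  end.

Lemma holds_rename_formula (D : Type) (E : D -> D -> Prop) phi f
    (e : nat -> D) :
  holds E e (rename_formula f phi) <-> holds E (e \o f) phi.
Proof.
elim: phi f e => [//|//|phi IH|phi IH psi IH'|phi IH] f e /=.
- by rewrite IH.
- by rewrite IH IH'.
- have lift_f x : scons x e \o (fun n => if n is m.+1 then (f m).+1 else 0) =
      scons x (e \o f) by apply/funext => -[].
  by split=> e_phi x; have := e_phi x; rewrite IH lift_f.
Qed.

Section Definability.
Variables (M : set V) (hM : countable_transitive_model M).

Local Notation D := {x : V | M x}.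
Local Notation E := (fun x y : D => vmem (proj1_sig x) (proj1_sig y)).

Lemma model_trans x y : M x -> vmem y x -> M y.
Proof. by case: hM => _ + _; exact. Qed.

Lemma model_val_inj (x y : D) : proj1_sig x = proj1_sig y -> x = y.
Proof. by case: x y => [x Mx] [y My] /= xy; exact: eq_exist. Qed.

Definition is_set_in (A : set V) : Prop :=
  exists2 b, M b & forall x, vmem x b <-> A x.

Definition env_in (e : nat -> V) : Prop := forall n, M (e n).

Definition assign (a : nat -> nat + D) (e : nat -> D) (n : nat) : D :=
  match a n with inl i => e i | inr x => x end.

(* [a] makes each variable of [phi] an argument or a parameter. *)
Definition definable (R : (nat -> V) -> Prop) : Prop :=
  exists (phi : formula) (a : nat -> nat + D), forall e : nat -> D,
    holds E (assign a e) phi <-> R (fun n => proj1_sig (e n)).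

Definition definable_fun (t : (nat -> V) -> V) : Prop :=
  (forall e, env_in e -> M (t e)) /\
  definable (fun e => e 0 = t (fun n => e n.+1)).

Lemma definable_ext R R' : (forall e, env_in e -> R e <-> R' e) ->
  definable R -> definable R'.
Proof.
move=> RR' [phi [a phiR]]; exists phi, a => e; rewrite phiR; apply: RR' => n.
exact: (proj2_sig (e n)).
Qed.

Lemma definable_rename f R : definable R -> definable (fun e => R (e \o f)).
Proof.
move=> [phi [a phiR]]; pose b n := if a n is inl i then inl (f i) else a n.
exists phi, b => e; rewrite -(phiR (e \o f)).
suff -> : assign a (e \o f) = assign b e by [].
by apply/funext => n; rewrite /assign /b; case: (a n).
Qed.

Lemma definable_not R : definable R -> definable (fun e => ~ R e).
Proof.
by move=> [phi [a phiR]]; exists (FNot phi), a => e /=; rewrite phiR.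
Qed.

Lemma definable_imp R R' : definable R -> definable R' ->
  definable (fun e => R e -> R' e).
Proof.
move=> [phi [a phiR]] [phi' [a' phiR']].
pose b n := if odd n then a' n./2 else a n./2.
exists (FImp (rename_formula double phi)
             (rename_formula (fun n => n.*2.+1) phi')), b.
move=> e /=; rewrite !holds_rename_formula -phiR -phiR'.
have -> : assign b e \o double = assign a e.
  by apply/funext => n; rewrite /= /assign /b odd_double doubleK.
suff -> : assign b e \o (fun n => n.*2.+1) = assign a' e by [].
by apply/funext => n; rewrite /= /assign /b /= odd_double /= uphalf_double.
Qed.

(* Turns the first [k] arguments into the [k] innermost bound variables. *)
Definition bind_vars k (a : nat -> nat + D) (n : nat) : nat :=
  if a n is inl i then if i < k then i else n + k else n + k.

Definition unbind_args k (a : nat -> nat + D) (n : nat) : nat + D :=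
  if a n is inl i then inl (i - k) else a n.

Lemma assign_bind1 a (e : nat -> D) x :
  scons x (assign (unbind_args 1 a) e) \o bind_vars 1 a = assign a (scons x e).
Proof.
apply/funext => n; rewrite /= /bind_vars /assign.
case an : (a n) => [[|i]|y] /=; rewrite ?addn1 //= /unbind_args an //.
by rewrite subn1.
Qed.

Lemma assign_bind2 a (e : nat -> D) x y :
  scons x (scons y (assign (unbind_args 2 a) e)) \o bind_vars 2 a =
  assign a (scons x (scons y e)).
Proof.
apply/funext => n; rewrite /= /bind_vars /assign.
case an : (a n) => [[|[|i]]|z] /=; rewrite ?addn2 //= /unbind_args an //.
by rewrite subn2.
Qed.

Lemma definable_all (R : V -> (nat -> V) -> Prop) :
  definable (fun e => R (e 0) (fun n => e n.+1)) ->
  definable (fun e => forall x, M x -> R x e).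
Proof.
move=> [phi [a phiR]].
exists (FAll (rename_formula (bind_vars 1 a) phi)), (unbind_args 1 a) => e /=.
have {}phiR x : holds E (scons x (assign (unbind_args 1 a) e))
      (rename_formula (bind_vars 1 a) phi) <->
    R (proj1_sig x) (fun n => proj1_sig (e n)).
  by rewrite holds_rename_formula assign_bind1 phiR.
split=> [e_phi x Mx|eR x]; first exact/(phiR (exist _ x Mx)).
by apply/phiR; apply: eR; exact: (proj2_sig x).
Qed.

Lemma definable_var_mem i j : definable (fun e => vmem (e i) (e j)).
Proof. by exists (FMem 0 1), (fun n => inl (if n is 0 then i else j)). Qed.

Lemma definable_var_eq i j : definable (fun e => e i = e j).
Proof.
exists (FEq 0 1), (fun n => inl (if n is 0 then i else j)) => e /=.
by split=> [/(congr1 (@proj1_sig _ _))//|]; exact: model_val_inj.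
Qed.

Lemma definable_var_eq_const i x : M x -> definable (fun e => e i = x).
Proof.
move=> Mx; pose a n : nat + D := if n is 0 then inl i else inr (exist _ x Mx).
exists (FEq 0 1), a => e /=.
by split=> [/(congr1 (@proj1_sig _ _))//|ex]; exact: model_val_inj.
Qed.

Lemma definable_and R R' : definable R -> definable R' ->
  definable (fun e => R e /\ R' e).
Proof.
move=> dR dR'.
apply: definable_ext (definable_not (definable_imp dR (definable_not dR'))).
by move=> e _; rewrite not_implyE notK.
Qed.

Lemma definable_or R R' : definable R -> definable R' ->
  definable (fun e => R e \/ R' e).
Proof.
move=> dR dR'; apply: definable_ext (definable_imp (definable_not dR) dR').
by move=> e _; rewrite implyE notK.
Qed.

Lemma definable_iff R R' : definable R -> definable R' ->
  definable (fun e => R e <-> R' e).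
Proof. by move=> dR dR'; apply: definable_and; exact: definable_imp. Qed.

Lemma definable_ex (R : V -> (nat -> V) -> Prop) :
  definable (fun e => R (e 0) (fun n => e n.+1)) ->
  definable (fun e => exists2 x, M x & R x e).
Proof.
move=> /definable_not dR.
apply: definable_ext
  (definable_not (definable_all (R := fun x e => ~ R x e) dR)).
move=> e _; split=> [some|[x Mx Rx] none]; last exact: none Rx.
by apply: contrapT => none; apply: some => x Mx Rx; apply: none; exists x.
Qed.

Lemma definable_subst t (R : V -> (nat -> V) -> Prop) : definable_fun t ->
  definable (fun e => R (e 0) (fun n => e n.+1)) ->
  definable (fun e => R (t e) e).
Proof.
move=> [Mt dt] dR.
apply: definable_ext (definable_ex
  (R := fun x e => x = t e /\ R x e) (definable_and dt dR)) => e Me.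
by split=> [[x _ [-> //]]|Rt]; exists (t e) => //; exact: Mt.
Qed.

Lemma definable_fun_rename f t : definable_fun t ->
  definable_fun (fun e => t (e \o f)).
Proof.
move=> [Mt dt]; split=> [e Me|]; first by apply: Mt => n; exact: Me.
have := definable_rename (fun n => if n is m.+1 then (f m).+1 else 0) dt.
by apply: definable_ext.
Qed.

Lemma definable_fun_shift t : definable_fun t ->
  definable_fun (fun e => t (fun n => e n.+1)).
Proof. exact: (definable_fun_rename succn). Qed.

Lemma definable_mem t t' : definable_fun t -> definable_fun t' ->
  definable (fun e => vmem (t e) (t' e)).
Proof.
move=> dt dt'; apply: (definable_subst (R := fun x e => vmem x (t' e)) dt).
apply: (definable_subst (R := fun y e => vmem (e 0) y)).
  exact: definable_fun_shift.
exact: definable_var_mem.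
Qed.

Lemma definable_eq t t' : definable_fun t -> definable_fun t' ->
  definable (fun e => t e = t' e).
Proof.
by move=> dt [_ dt']; apply: (definable_subst (R := fun x e => x = t' e) dt).
Qed.

Lemma definable_fun_var i : definable_fun (fun e => e i).
Proof. by split; [move=> e; exact | exact: definable_var_eq]. Qed.

Lemma definable_fun_const x : M x -> definable_fun (fun _ => x).
Proof. by move=> Mx; split=> //; exact: definable_var_eq_const. Qed.

Lemma definable_const Q : definable (fun _ => Q).
Proof.
have [q|nq] := pselect Q.
  by apply: definable_ext (definable_var_eq 0 0).
apply: definable_ext (definable_not (definable_var_eq 0 0)) => e _.
by split=> //; case.
Qed.

Lemma definable_ball t (R : V -> (nat -> V) -> Prop) : definable_fun t ->
  definable (fun e => R (e 0) (fun n => e n.+1)) ->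
  definable (fun e => forall x, vmem x (t e) -> R x e).
Proof.
move=> dt dR.
apply: definable_ext (definable_all (R := fun x e => vmem x (t e) -> R x e) _).
  move=> e /(proj1 dt) Mt; split=> eR x; last by move=> _; exact: eR.
  by move=> xt; apply: eR => //; exact: model_trans xt.
apply: definable_imp => //; apply: definable_mem;
  first exact: definable_fun_var.
exact: definable_fun_shift.
Qed.

Lemma definable_bex t (R : V -> (nat -> V) -> Prop) : definable_fun t ->
  definable (fun e => R (e 0) (fun n => e n.+1)) ->
  definable (fun e => exists2 x, vmem x (t e) & R x e).
Proof.
move=> dt dR.
apply: definable_ext (definable_ex (R := fun x e => vmem x (t e) /\ R x e) _).
  move=> e /(proj1 dt) Mt; split=> [[x _ [xt Rx]]|[x xt Rx]]; first by exists x.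
  by exists x => //; exact: model_trans xt.
apply: definable_and => //; apply: definable_mem;
  first exact: definable_fun_var.
exact: definable_fun_shift.
Qed.

Lemma definable_finite_all (T : Type) (A : set T)
  (R : T -> (nat -> V) -> Prop) :
  finite_set A -> (forall x, A x -> definable (R x)) ->
  definable (fun e => forall x, A x -> R x e).
Proof.
move: A; apply: finite_set_ind => [_|A x _ IH dR].
  by apply: definable_ext (definable_const True).
have dx : definable (R x) by apply: dR; left.
have dA : definable (fun e => forall y, A y -> R y e).
  by apply: IH => y Ay; apply: dR; right.
apply: definable_ext (definable_and dx dA) => e _.
by split=> [[Rx RA] y [->|/RA]|R'] //; split=> [|y Ay]; apply: R'; [left|right].
Qed.

Lemma model_separation (R : V -> (nat -> V) -> Prop) e a : env_in e -> M a ->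
  definable (fun e => R (e 0) (fun n => e n.+1)) ->
  is_set_in [set x | vmem x a /\ R x e].
Proof.
move=> Me Ma [phi [f phiR]]; have [_ _ [_ [_ separation _ _ _]]] := hM.
pose e' n : D := exist _ (e n) (Me n).
have [[b Mb] /= bE] := separation (rename_formula (bind_vars 1 f) phi)
  (assign (unbind_args 1 f) e') (exist _ a Ma).
have {}bE x (Mx : M x) : vmem x b <-> vmem x a /\ R x e.
  by rewrite (bE (exist _ x Mx)) holds_rename_formula assign_bind1 phiR.
exists b => // x; split=> [xb|[xa Rx]];
  first exact: (bE x (model_trans Mb xb)).1.
exact: (bE x (model_trans Ma xa)).2.
Qed.

Lemma model_replacement (R : V -> V -> (nat -> V) -> Prop) e a :
  env_in e -> M a ->
  definable (fun e => R (e 0) (e 1) (fun n => e n.+2)) ->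
  (forall x y z, vmem x a -> M y -> M z -> R x y e -> R x z e -> y = z) ->
  is_set_in [set y | M y /\ exists2 x, vmem x a & R x y e].
Proof.
move=> Me Ma [phi [f phiR]] R_fun; have [_ _ [_ [_ _ replacement _ _]]] := hM.
pose e' n : D := exist _ (e n) (Me n).
have {}phiR x y : holds E (scons x (scons y (assign (unbind_args 2 f) e')))
    (rename_formula (bind_vars 2 f) phi) <-> R (proj1_sig x) (proj1_sig y) e.
  by rewrite holds_rename_formula assign_bind2 phiR.
have [|[b Mb] /= bE] := replacement (rename_formula (bind_vars 2 f) phi)
    (assign (unbind_args 2 f) e') (exist _ a Ma).
  move=> x y z xa /phiR Rxy /phiR Rxz; apply: model_val_inj.
  exact: R_fun xa (proj2_sig y) (proj2_sig z) Rxy Rxz.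
exists b => // y; split=> [yb|[My [x xa Rxy]]].
  have My := model_trans Mb yb; split=> //.
  by have [/(_ yb)[x xa /phiR Rxy] _] := bE (exist _ y My);
    exists (proj1_sig x).
apply: (iffRL (bE (exist _ y My))).
by exists (exist _ x (model_trans Ma xa)) => //; exact/phiR.
Qed.

Lemma definable_fun_setof (A : (nat -> V) -> set V) :
  (forall e, env_in e -> is_set_in (A e)) ->
  definable (fun e => A (fun n => e n.+1) (e 0)) ->
  definable_fun (fun e => setof (A e)).
Proof.
move=> A_in dA.
have AE e : env_in e ->
    M (setof (A e)) /\ forall x, vmem x (setof (A e)) <-> A e x.
  by move=> /A_in[b Mb /predeqP bE]; rewrite -bE setof_elts.
split=> [e /AE[]//|].
apply: definable_ext (definable_all
  (R := fun x e => vmem x (e 0) <-> A (fun n => e n.+1) x) _); last first.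
  apply: definable_iff; first exact: definable_var_mem.
  exact: (definable_rename (fun n => if n is m.+1 then m.+2 else 0) dA).
move=> e Me; have [MA {}AE] := AE _ (fun n => Me n.+1).
split=> [e0E|-> x Mx]; last exact: AE.
apply: vmem_ext => x; split=> [xe|xA].
  by apply/AE/e0E => //; exact: model_trans xe.
by apply/e0E; [exact: model_trans xA|exact/AE].
Qed.

Lemma definable_fun_sep t (R : V -> (nat -> V) -> Prop) : definable_fun t ->
  definable (fun e => R (e 0) (fun n => e n.+1)) ->
  definable_fun (fun e => setof [set x | vmem x (t e) /\ R x e]).
Proof.
move=> dt dR.
apply: (definable_fun_setof (A := fun e => [set x | vmem x (t e) /\ R x e])).
  by move=> e Me; apply: model_separation => //; exact: (proj1 dt).
apply: definable_and => //; apply: definable_mem;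
  first exact: definable_fun_var.
exact: definable_fun_shift.
Qed.

Lemma definable_fun_image t (f : V -> (nat -> V) -> V) : definable_fun t ->
  definable_fun (fun e => f (e 0) (fun n => e n.+1)) ->
  definable_fun (fun e => setof [set f x e | x in elts (t e)]).
Proof.
move=> dt df.
have df' : definable_fun (fun e => f (e 0) (fun n => e n.+2)).
  exact: (definable_fun_rename (fun n => if n is m.+1 then m.+2 else 0) df).
apply: (definable_fun_setof (A := fun e => [set f x e | x in elts (t e)])).
  move=> e Me; have Mt := proj1 dt e Me.
  have [||b Mb bE] := model_replacement (R := fun x y e => y = f x e) Me Mt.
  - exact: definable_eq (definable_fun_var 1) df'.
  - by move=> x y z _ _ _ -> ->.
  exists b => // y; rewrite bE.
  split=> [[My [x xt ->]]|[x xt <-]]; first by exists x.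
  split; last by exists x.
  apply: (proj1 df (scons x e)) => -[|n]; last exact: Me.
  exact: model_trans Mt xt.
apply: (definable_bex (t := fun e => t (fun n => e n.+1))
   (R := fun x e => f x (fun n => e n.+1) = e 0));
     first exact: definable_fun_shift.
exact: definable_eq df' (definable_fun_var 1).
Qed.

Lemma definable_fun_pair t t' : definable_fun t -> definable_fun t' ->
  definable_fun (fun e => setof [set t e; t' e]).
Proof.
move=> dt dt'; apply: (definable_fun_setof (A := fun e => [set t e; t' e])).
  move=> e Me; have [_ _ [[_ _ pairing _] _]] := hM.
  have Mt := proj1 dt e Me; have Mt' := proj1 dt' e Me.
  have [[b Mb] /= bE] := pairing (exist _ (t e) Mt) (exist _ (t' e) Mt').
  exists b => // x; split=> [xb|].
    have /bE : vmem (proj1_sig (exist M x (model_trans Mb xb))) b by [].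
    by move=> [/(congr1 (@proj1_sig _ _))|/(congr1 (@proj1_sig _ _))];
      [left|right].
  by case=> ->; [apply: (iffRL (bE (exist _ _ Mt))); left|
    apply: (iffRL (bE (exist _ _ Mt'))); right].
by apply: definable_or; [case: dt|case: dt'].
Qed.

Lemma definable_fun_single t : definable_fun t ->
  definable_fun (fun e => setof [set t e]).
Proof.
move=> dt; have := definable_fun_pair dt dt; congr definable_fun.
by apply/funext => e; rewrite setUid.
Qed.

Lemma definable_fun_opair t t' : definable_fun t -> definable_fun t' ->
  definable_fun (fun e => opair (t e) (t' e)).
Proof.
move=> dt dt'; apply: definable_fun_pair; first exact: definable_fun_single.
exact: definable_fun_pair.
Qed.

Lemma definable_fun_union t : definable_fun t ->
  definable_fun (fun e => vunion (t e)).
Proof.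
move=> dt; apply: (definable_fun_setof
  (A := fun e => [set w | exists2 y, vmem y (t e) & vmem w y])).
  move=> e Me; have [_ _ [[_ _ _ union] _]] := hM; have Mt := proj1 dt e Me.
  have [[b Mb] /= bE] := union (exist _ (t e) Mt).
  exists b => // x; split=> [xb|[y yt xy]].
    have /bE[y xy yt] :
      vmem (proj1_sig (exist M x (model_trans Mb xb))) b by [].
    by exists (proj1_sig y).
  have My := model_trans Mt yt.
  by apply: (iffRL (bE (exist _ x (model_trans My xy)))); exists (exist _ y My).
apply: (definable_bex (t := fun e => t (fun n => e n.+1))
   (R := fun y e => vmem (e 0) y)); first exact: definable_fun_shift.
exact: definable_var_mem.
Qed.

Lemma definable_fun_cup t t' : definable_fun t -> definable_fun t' ->
  definable_fun (fun e => vcup (t e) (t' e)).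
Proof.
by move=> dt dt'; apply: definable_fun_union; exact: definable_fun_pair.
Qed.

Lemma is_set_in_bigcup (A : V -> set V) a : M a ->
  definable (fun e => A (e 1) (e 0)) ->
  (forall i, vmem i a -> is_set_in (A i)) ->
  is_set_in [set x | exists2 i, vmem i a & A i x].
Proof.
move=> Ma dA A_in.
have [|x y z xa My Mz Ay Az|b Mb bE] := model_replacement
    (R := fun i y _ => forall x, M x -> vmem x y <-> A i x) (fun _ => Ma) Ma.
- apply: (definable_all (R := fun x e => vmem x (e 1) <-> A (e 0) x)).
  apply: definable_iff; first exact: definable_var_mem.
  exact: (definable_rename (fun n => n) dA).
- apply: vmem_ext => w; split=> ww.
    by apply/Az/Ay => //; exact: model_trans ww.
  by apply/Ay/Az => //; exact: model_trans ww.
have [Mu _] := definable_fun_union (definable_fun_const Mb).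
exists (vunion b); first exact: (Mu (fun _ => b)).
move=> x; rewrite vmem_vunion; split=> [[y /bE[My [i ia yA]] xy]|[i ia Ax]].
  by exists i => //; apply/yA => //; exact: model_trans xy.
have [y My yA] := A_in i ia; exists y; last exact/yA.
by apply/bE; split=> //; exists i.
Qed.

Lemma model_nonempty : exists x, M x.
Proof. by have [_ _ [_ [[[w Mw] _] _ _ _ _]]] := hM; exists w. Qed.

Lemma model_definable_fun x : definable_fun (fun _ => x) -> M x.
Proof.
by move=> [Mx _]; have [w Mw] := model_nonempty; apply: (Mx (fun _ => w)).
Qed.

End Definability.

(** * Functions as sets of pairs *)

Definition vfield (f : V) : V := vunion (vunion f).

Definition vdom (f : V) : V :=
  setof [set x | vmem x (vfield f) /\
    exists2 y, vmem y (vfield f) & vmem (opair x y) f].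

Definition vran (f : V) : V :=
  setof [set y | vmem y (vfield f) /\
    exists2 x, vmem x (vfield f) & vmem (opair x y) f].

(** When [f] has several values at [x], or none, this is the union of them all. *)
Definition vapp (f x : V) : V :=
  vunion (setof [set y | vmem y (vfield f) /\ vmem (opair x y) f]).

Definition vprod (x y : V) : V :=
  vunion (setof [set setof [set opair u v | v in elts y] | u in elts x]).

Definition vrcons (s i : V) : V := vcup s (setof [set opair (vdom s) i]).

Lemma vmem_vfield x y f : vmem (opair x y) f ->
  vmem x (vfield f) /\ vmem y (vfield f).
Proof.
move=> xyf; have xy_union : vmem (setof [set x; y]) (vunion f).
  by apply/vmem_vunion; exists (opair x y) => //; apply/vmem2; right.
by split; apply/vmem_vunion; exists (setof [set x; y]) => //; apply/vmem2;
  [left|right].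
Qed.

Lemma vmem_vdom x f : vmem x (vdom f) <-> exists y, vmem (opair x y) f.
Proof.
rewrite vmem_sep; split=> [[_ [y _ xyf]]|[y xyf]]; first by exists y.
by have [xf yf] := vmem_vfield xyf; split=> //; exists y.
Qed.

Lemma vmem_vran y f : vmem y (vran f) <-> exists x, vmem (opair x y) f.
Proof.
rewrite vmem_sep; split=> [[_ [x _ xyf]]|[x xyf]]; first by exists x.
by have [xf yf] := vmem_vfield xyf; split=> //; exists x.
Qed.

Lemma vappE f x y : (forall y', vmem (opair x y') f <-> y' = y) -> vapp f x = y.
Proof.
move=> fx; apply: vmem_ext => z; rewrite vmem_vunion.
split=> [[y' /vmem_sep[_ /fx ->] //]|zy]; exists y => //; apply/vmem_sep.
have xyf : vmem (opair x y) f by exact/fx.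
by split=> //; have [] := vmem_vfield xyf.
Qed.

Lemma vmem_vprod z x y : vmem z (vprod x y) <->
  exists2 u, vmem u x & exists2 v, vmem v y & z = opair u v.
Proof.
rewrite vmem_vunion; split=> [[w]|[u ux [v vy ->]]].
  by move=> /vmem_image[u ux ->] /vmem_image[v vy ->]; exists u => //; exists v.
by exists (setof [set opair u v | v in elts y]); apply/vmem_image;
  [exists u|exists v].
Qed.

Definition vgraph (I : Type) (cI : I -> V) (f : I -> option V) : V :=
  setof [set z | exists i y, f i = Some y /\ z = opair (cI i) y].

Section Graph.
Variables (I : Type) (cI : I -> V).
Hypotheses (sI : small I) (cI_inj : injective cI).
Implicit Types f g : I -> option V.

Lemma vmem_vgraph z f :
  vmem z (vgraph cI f) <-> exists i y, f i = Some y /\ z = opair (cI i) y.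
Proof.
apply: vmem_setof.
have [x xE] := small_range (fun i => opair (cI i) (odflt (vnat 0) (f i))) sI.
by apply: (@is_set_sub x); rewrite xE => _ [i [y [fi ->]]]; exists i;
  rewrite ?fi.
Qed.

Lemma mem_vgraph i y f : vmem (opair (cI i) y) (vgraph cI f) <-> f i = Some y.
Proof.
rewrite vmem_vgraph; split=> [[j [z [fj /opair_inj[/cI_inj -> ->]]]] //|fi].
by exists i, y.
Qed.

Lemma mem_vdom_vgraph i f : vmem (cI i) (vdom (vgraph cI f)) <-> f i <> None.
Proof.
rewrite vmem_vdom; split=> [[y /mem_vgraph ->] //|].
by case fi : (f i) => [y|//] _; exists y; apply/mem_vgraph.
Qed.

Lemma vmem_vdom_vgraph x f :
  vmem x (vdom (vgraph cI f)) <-> exists2 i, f i <> None & x = cI i.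
Proof.
split=> [xf|[i fi ->]]; last exact/mem_vdom_vgraph.
have [y /vmem_vgraph[i [_ [_ /opair_inj[xi _]]]]] := (vmem_vdom _ _).1 xf.
by exists i => //; apply/mem_vdom_vgraph; rewrite -xi.
Qed.

Lemma vapp_vgraph i y f : f i = Some y -> vapp (vgraph cI f) (cI i) = y.
Proof.
by move=> fi; apply: vappE => z; rewrite mem_vgraph fi; split=> [[]|->].
Qed.

Lemma code_funE (T : Type) (cT : T -> V) (f : I -> T) :
  code_fun cI cT f = vgraph cI (fun i => Some (cT (f i))).
Proof.
congr setof; apply/predeqP => z.
by split=> [[i _ <-]|[i [y [[<-] ->]]]]; exists i => //; exists (cT (f i)).
Qed.

Lemma vapp_code_fun (T : Type) (cT : T -> V) (f : I -> T) i :
  vapp (code_fun cI cT f) (cI i) = cT (f i).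
Proof. by rewrite code_funE; exact: vapp_vgraph. Qed.

End Graph.

Lemma onth_SomeP (T : Type) (x0 : T) s n x :
  onth s n = Some x <-> n < size s /\ nth x0 s n = x.
Proof.
rewrite -onthTE -odflt_onth; case: (onth s n) => [y|] /=; last by split=> [|[]].
by split=> [[->]|[_ ->]].
Qed.

Definition vseq (T : Type) (c : T -> V) (xs : seq T) : V :=
  vgraph vnat (fun n => omap c (onth xs n)).

Section Seq.
Variables (T : Type) (c : T -> V).
Implicit Types xs : seq T.

Lemma vmem_vseq z xs :
  vmem z (vseq c xs) <->
    exists n x, onth xs n = Some x /\ z = opair (vnat n) (c x).
Proof.
rewrite vmem_vgraph //; split=> [[n [y []]]|[n [x [xn ->]]]].
  by case xn : (onth xs n) => [x|] //= [<-] ->; exists n, x.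
by exists n, (c x); rewrite xn.
Qed.

Lemma vdom_vseq xs : vdom (vseq c xs) = vnat (size xs).
Proof.
apply: vmem_ext => z; rewrite (vmem_vdom_vgraph _ vnat_inj) // vmem_vnat.
split=> -[n xn ->]; exists n => //.
  by rewrite -onthTE; case: (onth _ _) xn.
by move: xn; rewrite -onthTE; case: (onth _ _).
Qed.

Lemma vseq0 : vseq c [::] = vnat 0.
Proof.
apply: vmem_ext => z; rewrite vmem_vseq.
by split=> [[n [x []]]|/vmem_vnat0 //]; rewrite onth0n.
Qed.

Lemma vseq_rcons xs x : vrcons (vseq c xs) (c x) = vseq c (rcons xs x).
Proof.
apply: vmem_ext => z; rewrite vmem_vcup vmem1 vdom_vseq !vmem_vseq -cats1.
split=> [[[n [y [yn ->]]]|->]|[n [y [yn ->]]]].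
- by exists n, y; rewrite onth_cat -onthTE yn.
- by exists (size xs), x; rewrite onth_cat ltnn subnn.
move: yn; rewrite onth_cat; case: ltnP => [_ yn|xn]; first by left; exists n, y.
move=> /onth1P[/eqP]; rewrite subn_eq0 => nx ->; right.
by congr (opair (vnat _) _); apply/eqP; rewrite eqn_leq nx.
Qed.

Lemma vran_vseq y xs :
  vmem y (vran (vseq c xs)) <-> exists n x, onth xs n = Some x /\ y = c x.
Proof.
rewrite vmem_vran; split=> [[z]|[n [x [xn ->]]]].
  by move=> /vmem_vseq[n [x [xn /opair_inj[_ ->]]]]; exists n, x.
by exists (vnat n); apply/vmem_vseq; exists n, x.
Qed.

Lemma vran_vseq_cons y x xs :
  vmem y (vran (vseq c (x :: xs))) <-> y = c x \/ vmem y (vran (vseq c xs)).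
Proof.
rewrite !vran_vseq; split=> [[[|n] [z /= [xz ->]]]|[->|[n [z [xz ->]]]]].
- by left; case: xz => ->.
- by right; exists n, z.
- by exists 0, x.
- by exists n.+1, z.
Qed.

End Seq.

(** * Closure properties of a transitive model *)

(* Without the explicit [M], [definable_fun_var] would apply to every goal, by way
   of the first conjunct of [definable_fun]. *)
Ltac definability :=
  cbv beta delta [vapp vdom vran vfield vprod vrcons vsucc vsub];
  match goal with hM : countable_transitive_model ?M |- _ =>
  repeat (cbv beta; first
  [ eassumption
  | eapply (@definable_fun_var M)
  | eapply (@definable_fun_const M); solve [auto]
  | eapply (definable_fun_opair hM)
  | eapply (definable_fun_cup hM)
  | eapply (definable_fun_union hM)
  | eapply (definable_fun_single hM)
  | eapply (definable_fun_pair hM)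
  | eapply (definable_fun_sep hM)
  | eapply (definable_fun_image hM)
  | eapply (definable_ball hM)
  | eapply (definable_bex hM)
  | eapply (@definable_and M)
  | eapply (@definable_or M)
  | eapply (@definable_iff M)
  | eapply (@definable_not M)
  | eapply (@definable_imp M)
  | eapply (@definable_mem M)
  | eapply (@definable_eq M) ])
  end.

Section Closure.
Variables (M : set V) (hM : countable_transitive_model M).

Lemma model_vprod x y : M x -> M y -> M (vprod x y).
Proof. by move=> Mx My; apply: (model_definable_fun hM); definability. Qed.

Local Notation D := {x : V | M x}.
Local Notation E := (fun x y : D => vmem (proj1_sig x) (proj1_sig y)).

Lemma model_emptyP (z : D) : (forall x, ~ E x z) <-> proj1_sig z = vnat 0.
Proof.
split=> [z_empty|-> x]; last exact: vmem_vnat0.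
apply: vmem_ext => x; split=> [xz|/vmem_vnat0 //].
by case: (z_empty (exist _ x (model_trans hM (proj2_sig z) xz))).
Qed.

Lemma model_succP (n m : D) :
  (forall x, E x m <-> E x n \/ x = n) <-> proj1_sig m = vsucc (proj1_sig n).
Proof.
split=> [mE|-> x]; last first.
  rewrite vmem_vsucc; split=> -[]; [by left| |by left|by move=> ->; right].
  by move=> xn; right; exact: model_val_inj.
apply: vmem_ext => x; rewrite vmem_vsucc; split=> [xm|xn].
  have [/(_ xm) + _] := mE (exist _ x (model_trans hM (proj2_sig m) xm)).
  by case=> [|/(congr1 (@proj1_sig _ _))]; [left|right].
have Mx : M x.
  by case: xn => [|->];
    [exact: (model_trans hM (proj2_sig n))|exact: (proj2_sig n)].
apply: (mE (exist _ x Mx)).2; case: xn => [|xn]; [by left|right].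
exact: model_val_inj.
Qed.

Lemma model_vnat n : M (vnat n).
Proof.
elim: n => [|n Mn]; last first.
  by rewrite vnatS; apply: (model_definable_fun hM); definability.
have [_ _ [_ [[w [[z _ /model_emptyP <-] _]] _ _ _ _]]] := hM.
exact: (proj2_sig z).
Qed.

Lemma inductive_setP (w : D) : inductive_set E w <->
  vmem (vnat 0) (proj1_sig w) /\
  forall x, vmem x (proj1_sig w) -> vmem (vsucc x) (proj1_sig w).
Proof.
have Mw := proj2_sig w; split=> [[[z zw /model_emptyP <-] wS]|[w0 wS]];
  split=> //.
- move=> x xw;
    have [y yw /model_succP <- //] := wS (exist _ x (model_trans hM Mw xw)) xw.
- by exists (exist _ _ (model_vnat 0)) => //; apply/model_emptyP.
move=> x xw; exists (exist _ _ (model_trans hM Mw (wS _ xw))); first exact: wS.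
exact/model_succP.
Qed.

(* An element of the model's omega that is minimal among those that are not
   numerals could be removed, leaving a smaller inductive set. *)
Lemma model_vomega : M vomega.
Proof.
have [_ _ [_ [_ _ _ _ [[w Mw] [wI wmin] _]]]] := hM.
have [w0 wS] : vmem (vnat 0) w /\ forall x, vmem x w -> vmem (vsucc x) w.
  exact/(inductive_setP (exist _ w Mw)).
suff -> : vomega = w by [].
apply: vmem_ext => x; rewrite vmem_vomega; split=> [[n ->]|].
  by elim: n => [//|n nw]; rewrite vnatS; exact: wS.
elim/vmem_ind: x => x IH xw; apply: contrapT => xN.
have Mx := model_trans hM Mw xw.
pose v := setof [set y | vmem y w /\ y <> x].
have Mv : M v by apply: (model_definable_fun hM); definability.
have /wmin/(_ (exist _ x Mx) xw)/vmem_sep[] // : inductive_set E (exist _ v Mv).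
  apply/inductive_setP => /=.
  split=> [|y /vmem_sep[yw yx]]; apply/vmem_sep.
    by split=> // x0; apply: xN; exists 0.
  split=> [|yxS]; first exact: wS.
  have [|n yn] := IH y _ yw; first by rewrite -yxS; apply/vmem_vsucc; right.
  by apply: xN; exists n.+1; rewrite vnatS -yn.
Qed.

Definition vfinfun (f n X : V) : Prop :=
  (forall z, vmem z f ->
     exists2 k, vmem k n & exists2 x, vmem x X & z = opair k x) /\
  (forall k, vmem k n ->
     exists2 x, vmem x X &
       forall y, vmem y X -> (vmem (opair k y) f <-> y = x)).

Section Sequences.
Variables (T : Type) (c : T -> V) (X : V).
Hypotheses (MX : M X) (XE : forall z, vmem z X <-> exists t, z = c t).

Lemma vfinfunP f n :
  vfinfun f (vnat n) X <-> exists2 xs : seq T, size xs = n & f = vseq c xs.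
Proof.
split=> [[f_sub f_fun]|[xs <- ->]].
  have /choice[x xP] (k : 'I_n) : exists x,
      forall y, vmem (opair (vnat k) y) f <-> y = c x.
    have [|_ /XE[x ->] xP] := f_fun (vnat k).
      by apply/vmem_vnat; exists k.
    exists x => y; split=> [kf|yx]; last by apply/xP => //; apply/XE; exists x.
    by apply/xP => //; have [_ _ [y' ? /opair_inj[_ ->]]] := f_sub _ kf.
  have onth_x k (kn : k < n) :
      onth [seq x i | i <- enum 'I_n] k = Some (x (Ordinal kn)).
    rewrite onth_map onthE (nth_map (Ordinal kn)) ?size_enum_ord //=.
    by congr (Some (x _)); apply: val_inj; rewrite /= nth_enum_ord.
  exists [seq x i | i <- enum 'I_n]; first by rewrite size_map size_enum_ord.
  apply: vmem_ext => z; rewrite vmem_vseq; split=> [zf|[k [t [kt ->]]]].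
    have [_ /vmem_vnat[k kn ->] [y _ zE]] := f_sub _ zf.
    exists k, (x (Ordinal kn)); rewrite onth_x zE; split=> //.
    by congr opair; apply/(xP (Ordinal kn)); rewrite -zE.
  have kn : k < n by rewrite -[n](size_enum_ord n) -(size_map x) -onthTE kt.
  by move: kt; rewrite (onth_x _ kn) => -[<-]; exact/(xP (Ordinal kn)).
split=> [_ /vmem_vseq[k [t [kt ->]]]|_ /vmem_vnat[k + ->]].
  exists (vnat k); first by apply/vmem_vnat; exists k; rewrite // -onthTE kt.
  by exists (c t) => //; apply/XE; exists t.
rewrite -onthTE; case kt : (onth xs k) => [t|//] _.
exists (c t); first by apply/XE; exists t.
by move=> y _; rewrite mem_vgraph // ?kt; [split=> [[]|->]|exact: vnat_inj].
Qed.

Lemma is_set_in_vseq_size n :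
  is_set_in M [set z | exists2 xs : seq T, size xs = n & z = vseq c xs].
Proof.
elim: n => [|n [b Mb bE]].
  exists (setof [set vnat 0]).
    by have M0 := model_vnat 0; apply: (model_definable_fun hM); definability.
  move=> z; rewrite vmem1; split=> [->|[xs /size0nil -> ->]]; last exact: vseq0.
  by exists [::]; rewrite ?vseq0.
exists (vunion
  (setof [set setof [set vrcons g x | x in elts X] | g in elts b])).
  by apply: (model_definable_fun hM); definability.
move=> z; rewrite vmem_vunion; split=> [[w]|].
  move=> /vmem_image[g /bE[xs xsn ->] ->] /vmem_image[y /XE[x ->] ->].
  by exists (rcons xs x); rewrite ?size_rcons ?xsn // vseq_rcons.
case=> xs; elim/last_ind: xs => [//|xs x _]; rewrite size_rcons => -[xsn] ->.
exists (setof [set vrcons (vseq c xs) y | y in elts X]); apply/vmem_image.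
  by exists (vseq c xs) => //; apply/bE; exists xs.
by exists (c x); [apply/XE; exists x|rewrite vseq_rcons].
Qed.

Lemma is_set_in_vseq : is_set_in M [set z | exists xs : seq T, z = vseq c xs].
Proof.
have [||b Mb bE] :=
  is_set_in_bigcup hM (A := fun n f => vfinfun f n X) model_vomega.
- by rewrite /vfinfun; definability.
- move=> _ /vmem_vomega[n ->]; have [b Mb bE] := is_set_in_vseq_size n.
  by exists b => // z; rewrite bE; split=> /vfinfunP.
exists b => // z; rewrite bE; split=> [[_ /vmem_vomega[n ->]]|[xs ->]].
  by move=> /vfinfunP[xs _ ->]; exists xs.
exists (vnat (size xs)); first by apply/vmem_vomega; exists (size xs).
by apply/vfinfunP; exists xs.
Qed.

End Sequences.

Lemma finite_vran (T : Type) (c : T -> V) (xs : seq T) :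
  finite_set (elts (vran (vseq c xs))).
Proof.
elim: xs => [|x xs IH].
  by apply: (sub_finite_set _ (finite_set0 _)) => y /vran_vseq[n [x []]];
    rewrite onth0n.
apply: (@sub_finite_set _ _ (c x |` elts (vran (vseq c xs)))).
  by move=> y /vran_vseq_cons[->|]; [left|right].
by rewrite finite_setU; split=> //; exact: finite_set1.
Qed.

Lemma finite_vranP (T : Type) (c : T -> V) (A : set V) : finite_set A ->
  (forall y, A y -> exists x, y = c x) ->
  exists xs, forall y, vmem y (vran (vseq c xs)) <-> A y.
Proof.
move: A; apply: finite_set_ind => [_|A y _ IH Ac].
  by exists [::] => y; rewrite vran_vseq; split=> [[n [x []]]|[]];
    rewrite onth0n.
have [|xs xsE] := IH; first by move=> z Az; apply: Ac; right.
have [|x yE] := Ac y; first by left.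
by exists (x :: xs) => z; rewrite vran_vseq_cons xsE -yE.
Qed.

Lemma is_set_in_finite_subsets X : M X ->
  is_set_in M [set z | finite_set (elts z) /\ vsub z X].
Proof.
move=> MX; pose c := @proj1_sig V (vmem^~ X).
have cE y : vmem y X <-> exists x, y = c x.
  by split=> [yX|[[x xX] ->] //]; exists (exist _ y yX).
have [b Mb bE] := is_set_in_vseq MX cE.
exists (setof [set vran f | f in elts b]).
  by apply: (model_definable_fun hM); definability.
move=> z; rewrite vmem_image; split=> [[_ /bE[xs ->] ->]|[z_fin zX]].
  split=> [|_ /vran_vseq[n [x [_ ->]]]]; first exact: finite_vran.
  exact: (proj2_sig x).
have [xs xsE] := finite_vranP z_fin (fun y yz => (cE y).1 (zX y yz)).
exists (vseq c xs); first by apply/bE; exists xs.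
by apply: vmem_ext => y; rewrite xsE.
Qed.

Definition vfunctional (x y f : V) : Prop :=
  forall u, vmem u x -> forall v, vmem v y -> forall v', vmem v' y ->
    vmem (opair u v) f -> vmem (opair u v') f -> v = v'.

Section FiniteFunctions.
Variables (I : Type) (cI : I -> V) (J S : V).
Hypotheses (sI : small I) (cI_inj : injective cI).
Hypotheses (MJ : M J) (JE : forall z, vmem z J <-> exists i, z = cI i)
  (MS : M S).

Lemma vfunctionalP z : vsub z (vprod J S) -> vfunctional J S z ->
  exists2 f : I -> option V, z = vgraph cI f &
    forall i y, f i = Some y -> vmem y S.
Proof.
move=> zJS z_fun.
have mem_z i y : vmem (opair (cI i) y) z -> vmem y S.
  by move=> /zJS/vmem_vprod[_ _ [y' yS /opair_inj[_ ->]]].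
have /choice[f fP] (i : I) : exists o : option V,
    forall y, o = Some y <-> vmem (opair (cI i) y) z.
  have [[y iy]|nz] := pselect (exists y, vmem (opair (cI i) y) z); last first.
    by exists None => y; split=> // iy; case: nz; exists y.
  exists (Some y) => y'; split=> [[<-] //|iy']; congr Some.
  apply: (z_fun (cI i)) (mem_z _ _ iy) _ (mem_z _ _ iy') iy iy'.
  by apply/JE; exists i.
exists f => [|i y /fP]; last exact: mem_z.
apply: vmem_ext => w; rewrite vmem_vgraph //.
split=> [/[dup] wz /zJS/vmem_vprod[u /JE[i ->] [y _ wE]]|
  [i [y [/fP iy ->]]] //].
by exists i, y; split=> //; apply/fP; rewrite -wE.
Qed.

Lemma finite_vgraph (f : I -> option V) :
  finite_set (elts (vgraph cI f)) <-> finite_set [set i | f i <> None].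
Proof.
pose pair i := opair (cI i) (odflt (vnat 0) (f i)).
have pair_inj : {in [set i | f i <> None] &, injective pair}.
  by move=> i j _ _ /opair_inj[/cI_inj].
rewrite -(eq_finite_set (inj_card_eq pair_inj)).
suff -> : elts (vgraph cI f) = pair @` [set i | f i <> None] by [].
apply/predeqP => z; rewrite -[elts _ _]/(vmem _ _) vmem_vgraph //.
split=> [[i [y [fi ->]]]|[i /= fi <-]]; first by exists i; rewrite /= /pair fi.
by case fiE : (f i) fi => [y|//] _; exists i, y; rewrite /pair fiE.
Qed.

Lemma is_set_in_finite_graphs : is_set_in M [set z | exists f : I -> option V,
  [/\ finite_set [set i | f i <> None], forall i y, f i = Some y -> vmem y S
    & z = vgraph cI f]].
Proof.
have [F MF FE] := is_set_in_finite_subsets (model_vprod MJ MS).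
exists (setof [set z | vmem z F /\ vfunctional J S z]).
  by rewrite /vfunctional; apply: (model_definable_fun hM); definability.
move=> z; rewrite vmem_sep FE; split=> [[[z_fin zJS] z_fun]|[f [f_fin fS ->]]].
  have [f zE fS] := vfunctionalP zJS z_fun.
  by exists f; split=> //; apply/finite_vgraph; rewrite -zE.
split=> [|_ /JE[i ->] v _ v' _]; last by rewrite !mem_vgraph // => -> -[].
split=> [|_ /vmem_vgraph[//|i [y [fi ->]]]]; first exact/finite_vgraph.
apply/vmem_vprod; exists (cI i); first by apply/JE; exists i.
by exists y => //; exact: fS fi.
Qed.

Definition vcomplete (d z : V) : V :=
  vcup z (setof [set opair x d |
    x in elts (setof [set x | vmem x J /\ ~ vmem x (vdom z)])]).

Lemma vcomplete_vgraph d (f : I -> option V) :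
  vcomplete d (vgraph cI f) = code_fun cI id (fun i => odflt d (f i)).
Proof.
rewrite code_funE; apply: vmem_ext => z;
  rewrite vmem_vcup vmem_image !vmem_vgraph //.
split=> [[[i [y [fi ->]]]|[_ /vmem_sep[/JE[i ->] fi] ->]]|].
- by exists i, y; rewrite fi.
- by exists i, d; move: fi; rewrite mem_vdom_vgraph //; case: (f i) => // y [].
move=> [i [_ [[<-] ->]]]; case fi : (f i) => [y|]; first by left; exists i, y.
right; exists (cI i) => //; apply/vmem_sep; split; first by apply/JE; exists i.
by move=> /(mem_vdom_vgraph sI cI_inj); rewrite fi.
Qed.

Lemma is_set_in_finite_support d : M d ->
  is_set_in M [set z | exists f : I -> V,
  [/\ finite_set [set i | f i <> d], forall i, f i = d \/ vmem (f i) S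
    & z = code_fun cI id f]].
Proof.
move=> Md; have [F MF FE] := is_set_in_finite_graphs.
exists (setof [set vcomplete d z | z in elts F]).
  by rewrite /vcomplete; apply: (model_definable_fun hM); definability.
move=> z; rewrite vmem_image;
  split=> [[_ /FE[f [f_fin fS ->]] ->]|[f [f_fin fS ->]]].
  rewrite vcomplete_vgraph; exists (fun i => odflt d (f i)); split=> //.
    by apply: sub_finite_set f_fin => i /=; case: (f i).
  by move=> i; case fi : (f i) => [y|]; [right; exact: fS fi|left].
pose g i := if pselect (f i = d) then None else Some (f i).
exists (vgraph cI g).
  apply/FE; exists g; split=> //; last first.
    by move=> i y; rewrite /g; case: pselect => // fd [<-]; case: (fS i).
  by apply: sub_finite_set f_fin => i /=; rewrite /g; case: pselect.
rewrite vcomplete_vgraph; congr code_fun; apply/funext => i.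
by rewrite /g; case: pselect.
Qed.

End FiniteFunctions.
End Closure.

(** * Strings and trees *)

Lemma prefix_size_eq (T : eqType) (s t : seq T) :
  prefix s t -> size s = size t -> s = t.
Proof. by rewrite prefixE => /eqP + st; rewrite st take_size. Qed.

Lemma prefix_anti (T : eqType) (s t : seq T) :
  prefix s t -> prefix t s -> s = t.
Proof.
move=> st ts; apply: prefix_size_eq => //.
by apply/eqP; rewrite eqn_leq !size_prefix.
Qed.

Lemma prefix_nth (T : eqType) (x0 : T) (s t : seq T) : prefix s t <->
  forall n, n < size s -> n < size t /\ nth x0 t n = nth x0 s n.
Proof.
split=> [/prefixP[u ->] n ns|st];
  first by rewrite size_cat ltn_addr // nth_cat ns.
have le_st : size s <= size t.
  by rewrite leqNgt; apply/negP => /st[]; rewrite ltnn.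
rewrite prefixE; apply/eqP; apply: (@eq_from_nth _ x0); first exact: size_takel.
by move=> i; rewrite size_takel // => i_s; rewrite nth_take //;
  case: (st i i_s).
Qed.

Lemma comparable_strC s t : comparable_str s t -> comparable_str t s.
Proof. by case; [right|left]. Qed.

Lemma comparable_prefix s t :
  comparable_str s t -> size s <= size t -> prefix s t.
Proof.
case=> [//|ts] st; rewrite (prefix_size_eq ts) ?prefix_refl //.
by apply/eqP; rewrite eqn_leq st size_prefix.
Qed.

Lemma prefix_comparable (s t u : seq bool) :
  prefix s u -> prefix t u -> comparable_str s t.
Proof.
rewrite 2!prefixE => /eqP <- /eqP <-.
by case: (leqP (size s) (size t)) => [/take_takel <-|/ltnW/take_takel <-];
  [left|right]; exact: prefix_take.
Qed.

Lemma incomparable_split (s t : seq bool) : ~ comparable_str s t ->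
  exists u i, prefix (rcons u i) s /\ prefix (rcons u (~~ i)) t.
Proof.
elim: s t => [|a s IH] [|b t] st.
- by case: st; left.
- by case: st; left.
- by case: st; right.
have [ab|ab] := eqVneq a b; last first.
  by exists [::], a; case: a b ab {st} => -[] //=; rewrite !prefix0s.
have [|u [i [us ut]]] := IH t; last first.
  by exists (a :: u), i; rewrite /= -ab eqxx us.
by case=> prefix_st; apply: st; [left|right]; rewrite /= ab eqxx.
Qed.

Lemma finite_seq_size_lt (T : finType) n :
  finite_set [set s : seq T | size s < n].
Proof.
elim: n => [|n IH]; first by apply: (sub_finite_set _ (finite_set0 _)).
pose A := [set s : seq T | size s < n].
apply: (@sub_finite_set _ _ ([set [::]] `|` [set x :: s | x in setT & s in A])).
  by move=> [|x s] /= sn; [left|right; exists x => //; exists s].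
rewrite finite_setU; split; first exact: finite_set1.
by apply: finite_image2 => //; exact: finite_finset.
Qed.

Definition splits (T : tree) (t : seq bool) : Prop := forall i, T (rcons t i).

Lemma perfect_tree_min_split T : perfect_tree T ->
  exists2 t, splits T t & forall u, splits T u -> size t <= size u.
Proof.
move=> [_ [s0 Ts0] T_split].
have [n] : exists n, exists2 t, splits T t & size t = n.
  by have [t [_ t0 t1]] := T_split _ Ts0; exists (size t), t => // -[].
elim/ltn_ind: n => n IH [t t_splits tn].
have [[u u_splits un]|min] := pselect (exists2 u, splits T u & size u < n).
  by apply: IH un _; exists u.
exists t => // u u_splits; rewrite leqNgt; apply/negP => ut.
by apply: min; exists u; rewrite -?tn.
Qed.

Lemma min_split_stem T t : is_tree T -> splits T t ->
  (forall u, splits T u -> size t <= size u) -> is_stem T t.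
Proof.
move=> T_tree t_splits t_min; split=> [s Ts|s s_comp].
  apply: contrapT => /incomparable_split[u [i [ut us]]].
  have Tui : T (rcons u i).
    by apply: T_tree (t_splits true); apply: prefix_trans ut (prefix_rcons _ _).
  have Tui' := T_tree _ _ us Ts.
  have /t_min : splits T u by case: i Tui Tui' {ut us} => ? ? [].
  by rewrite leqNgt; have := size_prefix ut; rewrite size_rcons => ->.
have Tt : T t := T_tree _ _ (prefix_rcons t true) (t_splits true).
case: (leqP (size s) (size t)) => st.
  exact: comparable_prefix (s_comp _ Tt) st.
have ext i : prefix (rcons t i) s.
  by apply: comparable_prefix; rewrite ?size_rcons //;
    exact/comparable_strC/s_comp.
have /rcons_inj[] // : rcons t false = rcons t true.
apply: prefix_size_eq; last by rewrite !size_rcons.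
apply: comparable_prefix; last by rewrite !size_rcons.
exact: prefix_comparable (ext _) (ext _).
Qed.

Lemma stemE T t : is_stem T t -> stem T = t.
Proof.
move=> t_stem; have [stem_comp stem_max] : is_stem T (stem T).
  exact: (xgetPex [::] (P := [set s | is_stem T s]) (ex_intro _ t t_stem)).
by apply: prefix_anti; [exact: (proj2 t_stem)|exact: stem_max (proj1 t_stem)].
Qed.

Lemma perfect_tree_stem T :
  perfect_tree T -> is_stem T (stem T) /\ splits T (stem T).
Proof.
move=> T_perf; have [t t_splits t_min] := perfect_tree_min_split T_perf.
have t_stem : is_stem T t by case: T_perf => T_tree _ _; exact: min_split_stem.
by rewrite (stemE t_stem).
Qed.

Lemma perfect_setT : perfect_tree setT.
Proof.
split=> //; first by exists [::].
by move=> s _; exists s; split=> //; exact: prefix_refl.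
Qed.

Lemma perfect_tree_nil T : perfect_tree T -> T [::].
Proof. by move=> [T_tree [s Ts] _]; exact: T_tree (prefix0s _) Ts. Qed.

Lemma perfect_restrict T u : perfect_tree T -> T u ->
  perfect_tree (restrict_tree T u).
Proof.
move=> [T_tree _ T_split] Tu; split.
- move=> s t st [Tt ut]; split; first exact: T_tree Tt.
  case: ut => [ut|/(prefix_trans st)]; last by right.
  exact: prefix_comparable ut st.
- by exists u; split=> //; left; exact: prefix_refl.
move=> s [Ts us].
have [w [sw uw Tw]] : exists w, [/\ prefix s w, prefix u w & T w].
  by case: us => prefix_us; [exists s|exists u]; split=> //; exact: prefix_refl.
have [t [wt T0 T1]] := T_split w Tw.
have ut i : prefix u (rcons t i).
  exact: prefix_trans uw (prefix_trans wt (prefix_rcons _ _)).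
by exists t; split; [exact: prefix_trans wt|split=> //; left|split=> //; left].
Qed.

Lemma perfect_body_nonempty T : perfect_tree T -> body T !=set0.
Proof.
move=> T_perf; have [T_tree _ T_split] := T_perf.
have /choice[next nextP] s : exists i : bool, T s -> T (rcons s i).
  have [/T_split[t [/prefixP[[|i v] ->] t0 _]]|nTs] := pselect (T s).
  - by exists false => _; rewrite cats0 in t0.
  - exists i => _; apply: T_tree t0; apply: prefix_trans (prefix_rcons _ false).
    by rewrite -cat_rcons; exact: prefix_prefix.
  - by exists true.
pose node n := iter n (fun s => rcons s (next s)) [::].
exists (fun n => next (node n)) => n.
suff -> : mkseq (fun n => next (node n)) n = node n.
  by elim: n => [|n IH]; [exact: perfect_tree_nil|exact: nextP].
by elim: n => // n IH; rewrite mkseqS IH.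
Qed.

Lemma body_restrict T u x : body (restrict_tree T u) x -> mkseq x (size u) = u.
Proof.
move=> /(_ (size u))[_ ux]; apply/esym/prefix_size_eq; rewrite ?size_mkseq //.
by apply: comparable_prefix ux _; rewrite size_mkseq.
Qed.

Lemma body_sub T T' : T `<=` T' -> body T `<=` body T'.
Proof. by move=> TT' x xT n; exact: TT'. Qed.

(** * Codes *)

Section CodeSet.
Variables (T : Type) (c : T -> V).
Hypothesis sT : small T.
Implicit Types A B : set T.

Lemma vmem_code_set z A : vmem z (code_set c A) <-> exists2 t, A t & z = c t.
Proof.
rewrite /code_set vmem_setof; first by split=> [[t At <-]|[t At ->]]; exists t.
have [x xE] := small_range c sT.
by apply: (@is_set_sub x); rewrite xE => _ [t _ <-]; exists t.
Qed.

Hypothesis c_inj : injective c.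

Lemma mem_code_set t A : vmem (c t) (code_set c A) <-> A t.
Proof.
by rewrite vmem_code_set; split=> [[u Au /c_inj ->]|At] //; exists t.
Qed.

Lemma vsub_code_set A B : vsub (code_set c A) (code_set c B) <-> A `<=` B.
Proof.
split=> [AB t /mem_code_set/AB/mem_code_set|AB _ /vmem_code_set[t At ->]] //.
by apply/mem_code_set; exact: AB.
Qed.

Lemma code_set_inj : injective (code_set c).
Proof.
by move=> A B AB; apply/seteqP; split; apply/vsub_code_set; rewrite AB.
Qed.

End CodeSet.

Lemma is_set_in_code_set M (T : Type) (c : T -> V) A :
  is_set_in M [set z | exists2 t, A t & z = c t] -> M (code_set c A).
Proof.
move=> [b Mb bE]; rewrite /code_set;
  suff <- : elts b = c @` A by rewrite setof_elts.
apply/predeqP => z; apply: iff_trans (bE z) _.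
by split=> [[t At ->]|[t At <-]]; exists t.
Qed.

Lemma code_stringE s : code_string s = vseq (fun b : bool => vnat b) s.
Proof.
congr setof; apply/predeqP => z; split=> [[n ns <-]|[n [y []]]].
  have sn : onth s n = Some (nth false s n) by apply/onth_SomeP.
  by exists n, (vnat (nth false s n)); rewrite sn.
case sn : (onth s n) => [b|//] [<-] ->.
by have [ns <-] := (onth_SomeP false _ _ _).1 sn; exists n.
Qed.

Lemma mem_code_string n (i : bool) s :
  vmem (opair (vnat n) (vnat i)) (code_string s) <->
    n < size s /\ nth false s n = i.
Proof.
rewrite code_stringE vmem_vseq -onth_SomeP; split=> [|sn]; last by exists n, i.
move=> [m [b [sm /opair_inj[/vnat_inj -> /vnat_inj bi]]]].
by rewrite sm; move: bi; case: (i); case: b {sm}.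
Qed.

Lemma vdom_code_string s : vdom (code_string s) = vnat (size s).
Proof. by rewrite code_stringE vdom_vseq. Qed.

Lemma code_string_rcons s (i : bool) :
  vrcons (code_string s) (vnat i) = code_string (rcons s i).
Proof. by rewrite !code_stringE; exact: vseq_rcons. Qed.

Lemma vsub_code_string s t :
  vsub (code_string s) (code_string t) <-> prefix s t.
Proof.
rewrite (prefix_nth false); split=> [st n ns|st z].
  by apply/mem_code_string/st/mem_code_string.
rewrite {1}code_stringE => /vmem_vseq[n [i [/(onth_SomeP false)[ns <-] ->]]].
by apply/mem_code_string; exact: st.
Qed.

Lemma code_string_inj : injective code_string.
Proof.
by move=> s t st; apply: prefix_anti; apply/vsub_code_string; rewrite st.
Qed.

Lemma vmem_code_tree z T :
  vmem z (code_tree T) <-> exists2 s, T s & z = code_string s.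
Proof. exact: vmem_code_set. Qed.

Lemma mem_code_tree s T : vmem (code_string s) (code_tree T) <-> T s.
Proof. by apply: mem_code_set => //; exact: code_string_inj. Qed.

Lemma vsub_code_tree T T' : vsub (code_tree T) (code_tree T') <-> T `<=` T'.
Proof. by apply: vsub_code_set => //; exact: code_string_inj. Qed.

Lemma code_tree_inj : injective code_tree.
Proof. by apply: code_set_inj => //; exact: code_string_inj. Qed.

Lemma code_index_inj theta : injective (@code_index theta).
Proof.
move=> [[x xt] m] [[y yt] n] /opair_inj[/= xy /vnat_inj ->].
by congr pair; exact: eq_exist.
Qed.

#[local] Hint Resolve vnat_inj code_string_inj code_tree_inj code_index_inj :
  core.

Lemma vapp_index_fun theta (T : Type) (cT : T -> V) f p :
  vapp (code_fun (@code_index theta) cT f) (code_index p) = cT (f p).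
Proof. exact: vapp_code_fun. Qed.

Lemma vapp_code_multitree theta (tau : multitree theta) p :
  vapp (code_multitree tau) (code_index p) = code_tree (tau p).
Proof. exact: vapp_index_fun. Qed.

Lemma vapp_code_multisystem theta (Phi : multisystem theta) p :
  vapp (code_multisystem Phi) (code_index p) = code_system (Phi p).
Proof. exact: vapp_index_fun. Qed.

Lemma vapp_code_family theta (P : below theta -> set tree) xi :
  vapp (code_family P) (proj1_sig xi) = code_set code_tree (P xi).
Proof. by apply: vapp_code_fun => // -[x ?] [y ?] /= e; exact: eq_exist. Qed.

Lemma vapp_code_rname theta (c : rname theta) n (i : bool) :
  vapp (code_rname c) (opair (vnat n) (vnat i)) =
  code_set (@code_multitree theta) (c (n, i)).
Proof.
apply: (vapp_code_fun
  (cI := fun ni : nat * bool => opair (vnat ni.1) (vnat ni.2))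
  _ _ _ c (n, i)); first exact: small_type.
by move=> [m j] [m' j'] /opair_inj[/= /vnat_inj -> /vnat_inj]; case: j;
  case: j'.
Qed.

Lemma code_systemE phi :
  code_system phi = vgraph code_string (fun s => omap code_tree (phi s)).
Proof.
congr setof; apply/predeqP => z.
split=> [[s [T [phis ->]]]|[s [y []]]].
  by exists s, (code_tree T); rewrite phis.
by case phis : (phi s) => [T|//] [<-] ->; exists s, T.
Qed.

Lemma mem_vdom_code_system s phi :
  vmem (code_string s) (vdom (code_system phi)) <-> phi s.
Proof. by rewrite code_systemE mem_vdom_vgraph //; case: (phi s). Qed.

Lemma vmem_vdom_code_system z phi :
  vmem z (vdom (code_system phi)) <-> exists2 s, phi s & z = code_string s.
Proof.
rewrite code_systemE vmem_vdom_vgraph //.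
by split=> -[s phis ->]; exists s => //; case: (phi s) phis.
Qed.

Lemma vapp_code_system s T phi :
  phi s = Some T -> vapp (code_system phi) (code_string s) = code_tree T.
Proof.
by move=> phis; rewrite code_systemE; apply: vapp_vgraph; rewrite ?phis.
Qed.

Definition vstrings : V := code_set code_string setT.

Lemma vmem_vstrings z : vmem z vstrings <-> exists s, z = code_string s.
Proof. by rewrite vmem_code_set //; split=> [[s _ ->]|[s ->]]; exists s. Qed.

Lemma in_vstrings s : vmem (code_string s) vstrings.
Proof. by apply/vmem_vstrings; exists s. Qed.

Lemma in_vomega n : vmem (vnat n) vomega.
Proof. by apply/vmem_vomega; exists n. Qed.

Definition vindex (theta : V) : V := code_set (@code_index theta) setT.

Lemma vmem_vindex theta z :
  vmem z (vindex theta) <-> exists p, z = @code_index theta p.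
Proof. by rewrite vmem_code_set //; split=> [[p _ ->]|[p ->]]; exists p. Qed.

Lemma in_vindex theta p : vmem (@code_index theta p) (vindex theta).
Proof. by apply/vmem_vindex; exists p. Qed.

(** The code of a stem is the union of all strings comparable with the tree. *)
Definition vstem (T : V) : V :=
  vunion (setof [set s | vmem s vstrings /\
    forall t, vmem t T -> vsub s t \/ vsub t s]).

Lemma vstem_code_tree T : perfect_tree T ->
  vstem (code_tree T) = code_string (stem T).
Proof.
move=> /perfect_tree_stem[[stem_comp stem_max] _].
have compE s : (forall t, vmem t (code_tree T) ->
      vsub (code_string s) t \/ vsub t (code_string s)) <->
    forall t, T t -> comparable_str s t.
  split=> comp t => [/mem_code_tree/comp[]/vsub_code_string|].
  - by left.
  - by right.
  move=> /vmem_code_tree[u /comp[]su ->]; [left|right]; exact/vsub_code_string.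
apply: vsub_anti => z; last first.
  move=> zs; apply/vmem_vunion; exists (code_string (stem T)) => //;
    apply/vmem_sep.
  by split; [exact: in_vstrings|exact/compE].
move=> /vmem_vunion[_ /vmem_sep[/vmem_vstrings[s ->] /compE s_comp]].
by apply: (vsub_code_string _ _).2 z; exact: stem_max.
Qed.

Definition vsplitting (Q phi : V) : Prop :=
  (exists2 n, vmem n vomega &
     forall s, vmem s vstrings -> (vmem s (vdom phi) <-> vmem (vdom s) n)) /\
  (forall s, vmem s (vdom phi) -> vmem (vapp phi s) Q) /\
  (forall s, vmem s (vdom phi) -> forall i, vmem i (vnat 2) ->
     vmem (vrcons s i) (vdom phi) ->
     vsub (vapp phi (vrcons s i)) (vapp phi s) /\
     vsub (vrcons (vstem (vapp phi s)) i) (vstem (vapp phi (vrcons s i)))).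

Section SplittingSystem.
Variables (Q : set tree) (phi : system).

Lemma vheightP n :
  (forall s, vmem s vstrings ->
     (vmem s (vdom (code_system phi)) <-> vmem (vdom s) (vnat n))) <->
  forall s, isSome (phi s) = (size s < n).
Proof.
have size_lt s : vmem (vdom (code_string s)) (vnat n) <-> size s < n.
  rewrite vdom_code_string vmem_vnat.
  by split=> [[m mn /vnat_inj ->]|sn] //; exists (size s).
split=> phi_n s; last first.
  by move=> /vmem_vstrings[t ->]; rewrite mem_vdom_code_system size_lt phi_n.
apply/idP/idP => [/mem_vdom_code_system/(phi_n _ (in_vstrings s))/size_lt //|].
by move=> /size_lt/(phi_n _ (in_vstrings s))/mem_vdom_code_system.
Qed.

Lemma vnodesP :
  (forall s, vmem s (vdom (code_system phi)) ->
     vmem (vapp (code_system phi) s) (code_set code_tree Q)) <->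
  forall s T, phi s = Some T -> Q T.
Proof.
split=> [phiQ s T phis|phiQ _ /vmem_vdom_code_system[s + ->]].
  have := phiQ (code_string s); rewrite (vapp_code_system phis) mem_code_set //.
  by apply; apply/mem_vdom_code_system; rewrite phis.
case phis : (phi s) => [T|//] _; rewrite (vapp_code_system phis).
by apply/mem_code_set => //; exact: phiQ phis.
Qed.

Hypothesis Q_perfect : Q `<=` perfect_tree.

Lemma vstem_incr s i T T' : phi s = Some T -> phi (rcons s i) = Some T' ->
  Q T -> Q T' ->
  (vsub (vapp (code_system phi) (vrcons (code_string s) (vnat i)))
     (vapp (code_system phi) (code_string s)) /\
   vsub (vrcons (vstem (vapp (code_system phi) (code_string s))) (vnat i))
     (vstem (vapp (code_system phi) (vrcons (code_string s) (vnat i))))) <->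
  T' `<=` T /\ prefix (rcons (stem T) i) (stem T').
Proof.
move=> phis phisi /Q_perfect T_perf /Q_perfect T'_perf.
rewrite code_string_rcons (vapp_code_system phis) (vapp_code_system phisi).
rewrite !vstem_code_tree // code_string_rcons.
by rewrite vsub_code_tree vsub_code_string.
Qed.

Lemma vsplittingP :
  vsplitting (code_set code_tree Q) (code_system phi) <->
    splitting_system Q phi.
Proof.
split=> [[[_ /vmem_vomega[n ->] /vheightP phi_n] [/vnodesP phiQ phi_split]]|].
  split=> // [|s i T T' phis phisi]; first by exists n.
  apply/(vstem_incr phis phisi); [exact: phiQ phis|exact: phiQ phisi|].
  apply: phi_split.
  - by apply/mem_vdom_code_system; rewrite phis.
  - by apply/vmem_vbool; exists i.
  - by rewrite code_string_rcons; apply/mem_vdom_code_system; rewrite phisi.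
move=> [[n phi_n] phiQ phi_split].
split; first by exists (vnat n); [exact: in_vomega|exact/vheightP].
split; first exact/vnodesP.
move=> _ /vmem_vdom_code_system[s + ->] _ /vmem_vbool[i ->].
rewrite {1}code_string_rcons mem_vdom_code_system.
case phis : (phi s) => [T|//] _; case phisi : (phi (rcons s i)) => [T'|//] _.
apply/(vstem_incr phis phisi); [exact: phiQ phis|exact: phiQ phisi|].
exact: phi_split phis phisi.
Qed.

End SplittingSystem.

(** * Multitrees and multisystems in a model *)

Section ModelCodes.
Variables (M : set V) (hM : countable_transitive_model M).

Lemma model_vstrings : M vstrings.
Proof.
have M2 := model_vnat hM 2.
have [b Mb bE] := is_set_in_vseq hM M2 vmem_vbool.
apply: is_set_in_code_set; exists b => // z; rewrite bE.
by split=> [[s ->]|[s _ ->]]; exists s; rewrite ?code_stringE.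
Qed.

Lemma model_code_string s : M (code_string s).
Proof. exact: (model_trans hM model_vstrings (in_vstrings s)). Qed.

Variables (theta : V) (Mtheta : M theta).

Lemma model_vindex : M (vindex theta).
Proof.
apply: is_set_in_code_set; exists (vprod theta vomega).
  by apply: model_vprod => //; exact: model_vomega.
move=> z; rewrite vmem_vprod.
split=> [[x xtheta [_ /vmem_vomega[n ->] ->]]|[p _ ->]].
  by exists (exist _ x xtheta, n).
exists (proj1_sig p.1); first exact: (proj2_sig p.1).
by exists (vnat p.2); first exact: in_vomega.
Qed.

Lemma model_code_index p : M (@code_index theta p).
Proof. exact: (model_trans hM model_vindex (in_vindex p)). Qed.

Variables (P : below theta -> set tree) (MP : M (code_family P)).

Definition family_trees : set tree := [set T | exists xi, P xi T].

Lemma model_family_trees : M (code_set code_tree family_trees).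
Proof.
apply: is_set_in_code_set.
exists (vunion (setof [set vapp (code_family P) x | x in elts theta])).
  by apply: (model_definable_fun hM); definability.
move=> z; rewrite vmem_vunion;
  split=> [[w /vmem_image[x xtheta ->]]|[T [xi PT] ->]].
  rewrite (vapp_code_family P (exist _ x xtheta)) vmem_code_set // =>
    -[T PT ->].
  by exists T => //; exists (exist _ x xtheta).
exists (code_set code_tree (P xi)); last by apply/mem_code_set.
apply/vmem_image; exists (proj1_sig xi); first exact: (proj2_sig xi).
by rewrite vapp_code_family.
Qed.

Lemma model_code_tree xi T : P xi T -> M (code_tree T).
Proof.
move=> PT; apply: (model_trans hM model_family_trees).
by apply/mem_code_set => //; exists xi.
Qed.

Lemma model_finite_support (U : Type) (c : U -> V) (A : below theta -> set U)
    (u0 : U) (S : V) (R : V -> V -> Prop) :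
  injective c -> M S -> M (c u0) ->
  (forall y, vmem y S -> exists u, y = c u) ->
  (forall xi u, A xi u -> u = u0 \/ vmem (c u) S) ->
  definable M (fun e => R (e 0) (e 1)) ->
  (forall xi u, R (proj1_sig xi) (c u) <-> A xi u) ->
  M (code_set (code_fun (@code_index theta) c)
       [set tau | (forall p, A p.1 (tau p)) /\
         finite_set [set p | tau p <> u0]]).
Proof.
move=> c_inj MS Mu0 S_codes A_S dR R_A; have Momega := model_vomega hM.
have [F MF FE] := is_set_in_finite_support hM (small_index theta)
  (@code_index_inj theta) model_vindex (@vmem_vindex theta) MS Mu0.
apply: is_set_in_code_set; exists (setof [set z | vmem z F /\
  forall xi, vmem xi theta -> forall k, vmem k vomega ->
    R xi (vapp z (opair xi k))]).
  apply: (model_definable_fun hM); definability.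
  apply: (definable_subst (R := fun y e => R (e 1) y)); last first.
    exact: (definable_rename (fun n => if n is 0 then 2 else 0) dR).
  by definability.
move=> z; rewrite vmem_sep FE; split=> [[[f [f_fin f_S ->]] f_R]|].
  have /choice[tau tauE] p : exists u, f p = c u.
    by case: (f_S p) => [->|/S_codes //]; exists u0.
  exists tau; last by congr code_fun; apply/funext.
  split=> [p|]; last first.
    by apply: sub_finite_set f_fin => p /=; rewrite tauE;
      apply: contra_not => /c_inj.
  have := f_R _ (proj2_sig p.1) _ (in_vomega p.2).
  by rewrite (vapp_index_fun id f p) tauE R_A.
move=> [tau [tau_A tau_fin] ->].
split=> [|xi xitheta _ /vmem_vomega[k ->]]; last first.
  rewrite (vapp_index_fun c tau (exist _ xi xitheta, k)).
  exact: (R_A (exist _ xi xitheta) _).2 (tau_A (exist _ xi xitheta, k)).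
exists (c \o tau); split=> //.
  by apply: sub_finite_set tau_fin => p /=; apply: contra_not => ->.
by move=> p; case: (A_S p.1 _ (tau_A p)) => [/= ->|]; [left|right].
Qed.

Lemma model_multitrees : M (code_set (@code_multitree theta) (MT P)).
Proof.
have Mstrings := model_vstrings.
apply: (model_finite_support (A := fun xi T => P xi T \/ T = setT) (u0 := setT)
  (R := fun x y => vmem y (vapp (code_family P) x) \/ y = vstrings)
  _ model_family_trees) => //.
- by move=> y; rewrite vmem_code_set // => -[T _ ->]; exists T.
- move=> xi T [PT|->]; [right|by left].
  by apply/mem_code_set => //; exists xi.
- by definability.
move=> xi T; rewrite vapp_code_family mem_code_set //.
by split=> -[]; [left|move=> /code_tree_inj ->; right|left|move=> ->; right].
Qed.

Lemma is_set_in_finite_systems : is_set_in M [set z | exists phi : system,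
  [/\ finite_set [set s | isSome (phi s)],
      forall s T, phi s = Some T -> family_trees T & z = code_system phi]].
Proof.
have [F MF FE] :=
  is_set_in_finite_graphs hM (small_type (seq bool)) code_string_inj
  model_vstrings vmem_vstrings model_family_trees.
exists F => // z; rewrite FE.
split=> [[f [f_fin f_trees ->]]|[phi [phi_fin phi_trees ->]]].
  have /choice[phi phiE] s : exists o : option tree,
      f s = omap code_tree o /\ forall T, o = Some T -> family_trees T.
    case fs : (f s) => [y|]; last by exists None.
    have /vmem_code_set[//|T PT ->] := f_trees _ _ fs.
    by exists (Some T); split=> // _ [<-].
  exists phi; split.
  - by apply: sub_finite_set f_fin => s /=; case: (phiE s) => -> _;
      case: (phi s).
  - by move=> s T; case: (phiE s) => _; exact.
  by rewrite code_systemE; congr vgraph; apply/funext => s; case: (phiE s).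
exists (omap code_tree \o phi); split; last exact: code_systemE.
  by apply: sub_finite_set phi_fin => s /=; case: (phi s).
move=> s y /=; case phis : (phi s) => [T|//] [<-].
by apply/mem_code_set => //; exact: phi_trees phis.
Qed.

Lemma finite_splitting_system Q phi :
  splitting_system Q phi -> finite_set [set s | isSome (phi s)].
Proof.
move=> [[n phi_n] _ _]; apply: sub_finite_set (finite_seq_size_lt _ n) => s /=.
by rewrite phi_n.
Qed.

Lemma code_system_None : code_system (fun _ => None) = vnat 0.
Proof.
rewrite code_systemE; apply: vmem_ext => z; rewrite vmem_vgraph //.
by split=> [[s [y []]]|/vmem_vnat0].
Qed.

Lemma code_system_inj : injective code_system.
Proof.
move=> phi psi e; apply/funext => s.
have := mem_vdom_code_system s phi; rewrite e mem_vdom_code_system.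
case phis : (phi s) => [T|]; case psis : (psi s) => [T'|] // -[psi_phi phi_psi].
- congr Some; apply: code_tree_inj.
  by rewrite -(vapp_code_system phis) e (vapp_code_system psis).
- by have := phi_psi isT.
by have := psi_phi isT.
Qed.

Hypothesis hP : forall xi, ptforcing (P xi).

Lemma model_multisystems : M (code_set (@code_multisystem theta) (MS P)).
Proof.
have Mstrings := model_vstrings; have Momega := model_vomega hM.
have M2 := model_vnat hM 2; have [S MS SE] := is_set_in_finite_systems.
rewrite (_ : Defs.MS P =
    [set Phi | (forall p, splitting_system (P p.1) (Phi p)) /\
    finite_set [set p | Phi p <> (fun _ => None)]]).
  apply: (model_finite_support (A := fun xi => splitting_system (P xi)) (S := S)
    (R := fun x y => vsplitting (vapp (code_family P) x) y)) => //.
  - exact: code_system_inj.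
  - by rewrite code_system_None; exact: model_vnat.
  - by move=> y /SE[phi [_ _ ->]]; exists phi.
  - move=> xi phi phiP; right; apply/SE; exists phi; split=> //.
      exact: finite_splitting_system phiP.
    by move=> s T phis; exists xi; case: phiP => _ phiP _; exact: phiP phis.
  - by rewrite /vsplitting /vstem; definability.
  by move=> xi phi; rewrite vapp_code_family; apply: vsplittingP;
    exact: (proj1 (hP xi)).
suff nonempty (Phi : multisystem theta) : [set p | exists s, isSome (Phi p s)] =
    [set p | Phi p <> (fun _ => None)].
  by apply/predeqP => Phi; rewrite /Defs.MS /= nonempty.
apply/predeqP => p; split=> [[s +] e|/= phi_p]; first by rewrite e.
apply: contrapT => none; apply: phi_p; apply/funext => s.
by case phis : (Phi p s) => [T|//]; case: none; exists s; rewrite phis.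
Qed.

Lemma model_definable_multisystems (R : V -> Prop) :
  definable M (fun e => R (e 0)) ->
  M (code_set (@code_multisystem theta)
      [set Phi | MS P Phi /\ R (code_multisystem Phi)]).
Proof.
move=> dR; have MMS := model_multisystems; apply: is_set_in_code_set.
exists (setof [set z | vmem z (code_set (@code_multisystem theta) (MS P)) /\
  R z]).
  by apply: (model_definable_fun hM); definability; exact: dR.
move=> z; rewrite vmem_sep vmem_code_set //.
split=> [[[Phi Phi_P ->] RPhi]|[Phi [Phi_P RPhi] ->]]; first by exists Phi.
by split=> //; exists Phi.
Qed.

End ModelCodes.

(** * Multitrees and direct forcing *)

Section Multitrees.
Variable theta : V.
Implicit Types (rho sigma tau : multitree theta) (p q : Defs.index theta).

Lemma mt_le_refl tau : mt_le tau tau.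
Proof. by move=> p x. Qed.

#[local] Hint Resolve mt_le_refl : core.

Lemma mt_le_trans sigma rho tau :
  mt_le rho sigma -> mt_le sigma tau -> mt_le rho tau.
Proof. by move=> rs st p; exact: subset_trans (rs p) (st p). Qed.

Lemma support_le sigma tau : mt_le sigma tau ->
  Defs.support tau `<=` Defs.support sigma.
Proof.
move=> st p; apply: contra_not => sp; apply/seteqP; split=> // x _.
by apply: st; rewrite sp.
Qed.

Lemma mt_body_le sigma tau : mt_le sigma tau -> mt_body sigma `<=` mt_body tau.
Proof.
by move=> st x xs p pt; exact: body_sub (st p) _ (xs p (support_le st pt)).
Qed.

Lemma forces_value_le sigma tau (c : rname theta) n i :
  mt_le sigma tau -> forces_value tau c n i -> forces_value sigma c n i.
Proof.
move=> /mt_body_le st [S [fS Sc tS]]; exists S; split=> //.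
exact: subset_trans st tS.
Qed.

Lemma forces_initial_le sigma tau (c : rname theta) s :
  mt_le sigma tau -> forces_initial tau c s -> forces_initial sigma c s.
Proof. by move=> st ts n ns; exact: forces_value_le st (ts n ns). Qed.

Lemma forces_neq_le sigma tau (c d : rname theta) :
  mt_le sigma tau -> forces_neq tau c d -> forces_neq sigma c d.
Proof.
move=> st [s [t [incomp tau_s tau_t]]]; exists s, t.
by split=> //; apply: forces_initial_le st _.
Qed.

Lemma forces_initial_pi tau q s x :
  forces_initial tau (pi_name q) s -> mt_body tau x -> mkseq (x q) (size s) = s.
Proof.
move=> ts xtau; apply: (@eq_from_nth _ false); rewrite size_mkseq // => n ns.
rewrite nth_mkseq //; have [S [_ S_pi /(_ x xtau)[sigma /S_pi -> x_rho]]] :=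
  ts n ns.
have : Defs.support (rho q n (nth false s n)) q.
  move=> e.
  have : rho q n (nth false s n) q (nseq n.+1 (~~ nth false s n)) by rewrite e.
  by move=> /(_ erefl); rewrite size_nseq nth_nseq ltnSn => /(_ isT); case: nth.
move=> /x_rho/(_ n.+1)/(_ erefl); rewrite size_mkseq nth_mkseq //; exact.
Qed.

Definition mt_update tau p T : multitree theta :=
  fun q => if pselect (q = p) then T else tau q.

Lemma mt_update_same tau p T : mt_update tau p T p = T.
Proof. by rewrite /mt_update; case: pselect. Qed.

Lemma mt_update_le tau p T : T `<=` tau p -> mt_le (mt_update tau p T) tau.
Proof.
by move=> Tp q x; rewrite /mt_update; case: pselect => [qp|_] //= Tx;
  rewrite qp; exact: Tp.
Qed.

Section Conditions.
Variable P : below theta -> set tree.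

Lemma MT_update tau p T : MT P tau -> P p.1 T -> MT P (mt_update tau p T).
Proof.
move=> [tau_P tau_fin] PT; split=> [q|].
  by rewrite /mt_update; case: pselect => [qp|_] /=;
    [left; rewrite qp|exact: tau_P].
apply: (@sub_finite_set _ _ (p |` Defs.support tau)).
  by move=> q; rewrite /Defs.support /= /mt_update; case: pselect; [left|right].
by rewrite finite_setU; split=> //; exact: finite_set1.
Qed.

Lemma MT_setT : MT P (fun _ => setT).
Proof.
by split=> [p|]; [right|apply: (sub_finite_set _ (finite_set0 _)) => p []].
Qed.

Hypothesis hP : forall xi, ptforcing (P xi).

Lemma MT_perfect tau p : MT P tau -> perfect_tree (tau p).
Proof.
by move=> [/(_ p)[/(proj1 (hP p.1)) //|-> _]]; exact: perfect_setT.
Qed.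

Lemma MT_restrict tau p u : MT P tau -> P p.1 (tau p) -> tau p u ->
  MT P (mt_update tau p (restrict_tree (tau p) u)).
Proof.
by move=> tauP Ptau tau_u; apply: MT_update => //; exact: (proj2 (hP p.1)).
Qed.

Lemma mt_body_through tau p u : MT P tau -> tau p u ->
  exists2 x, mt_body tau x & mkseq (x p) (size u) = u.
Proof.
move=> tauP tau_u.
have perf q : perfect_tree (mt_update tau p (restrict_tree (tau p) u) q).
  rewrite /mt_update; case: pselect => ? /=; last exact: MT_perfect.
  by apply: perfect_restrict tau_u; exact: MT_perfect.
have /choice[x xP] := fun q => perfect_body_nonempty (perf q).
exists x; last by have := xP p; rewrite mt_update_same => /body_restrict.
move=> q _; apply: body_sub (xP q); apply: mt_update_le; exact: subIsetl.
Qed.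

Lemma mt_body_nonempty tau : MT P tau -> mt_body tau !=set0.
Proof.
move=> tauP; have /choice[x xP] :=
  fun q => perfect_body_nonempty (MT_perfect q tauP).
by exists x => q _; exact: xP.
Qed.

(* Replacing the full components of [tau] by those of [sigma], either the result
   is below [sigma], or one of its components has a node outside [sigma]. *)
Lemma compatible_or_disjoint sigma tau : MT P sigma -> MT P tau ->
  compatible P sigma tau \/
  exists2 rho, MT P rho /\ mt_le rho tau & mt_body rho `&` mt_body sigma = set0.
Proof.
move=> sigmaP tauP.
pose tau' p := if pselect (tau p = setT) then sigma p else tau p.
have tau'_le : mt_le tau' tau.
  by move=> p; rewrite /tau'; case: pselect => [tT|] x //= _; rewrite tT.
have tau'P : MT P tau'.
  split=> [p|].
    by rewrite /tau'; case: pselect => ? /=; [case: sigmaP|case: tauP].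
  apply: (@sub_finite_set _ _ (Defs.support sigma `|` Defs.support tau)).
    by move=> p; rewrite /Defs.support /= /tau'; case: pselect; [left|right].
  by rewrite finite_setU; split; [case: sigmaP|case: tauP].
have [tau'_sigma|] := pselect (mt_le tau' sigma); first by left; exists tau'.
move=> /existsNP[p] /existsNP[u] /not_implyP[tau'u sigma_u]; right.
have sigma_p : Defs.support sigma p by move=> e; apply: sigma_u; rewrite e.
have P_tau' : P p.1 (tau' p).
  by rewrite /tau'; case: pselect => tT /=;
    [case: sigmaP|case: tauP] => /(_ p)[].
exists (mt_update tau' p (restrict_tree (tau' p) u)).
  split; first exact: MT_restrict.
  by apply: mt_le_trans tau'_le; apply: mt_update_le; exact: subIsetl.
have rho_p : restrict_tree (tau' p) u <> setT.
  move=> e; apply: sigma_p; have : tau' p = setT.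
    by apply/seteqP; split=> // y _;
      have [] : restrict_tree (tau' p) u y by rewrite e.
  by rewrite /tau'; case: pselect.
apply/seteqP; split=> // x [x_rho /(_ p sigma_p)/(_ (size u)) x_sigma];
  apply: sigma_u.
by have := x_rho p;
  rewrite /Defs.support /= mt_update_same => /(_ rho_p)/body_restrict <-.
Qed.

Lemma compatible_of_cover (S : set (multitree theta)) :
  finite_set S -> S `<=` MT P ->
  forall tau, MT P tau -> mt_body tau `<=` \bigcup_(sigma in S) mt_body sigma ->
  exists2 sigma, S sigma & compatible P sigma tau.
Proof.
move: S; apply: finite_set_ind =>
  [_ tau tauP cover|S sigma _ IH SP tau tauP cover].
  by have [x /cover[]] := mt_body_nonempty tauP.
have sigmaP : MT P sigma by apply: SP; left.
have [comp|[rho [rhoP rho_le] disj]] := compatible_or_disjoint sigmaP tauP.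
  by exists sigma; [left|].
have [|x x_rho|sigma' Ssigma' [r [rP rs' rrho]]] := IH _ _ rhoP.
- by move=> s Ss; apply: SP; right.
- have [s [->|Ss] xs] := cover x (mt_body_le rho_le x_rho); last by exists s.
  by have : set0 x by rewrite -disj.
exists sigma'; first by right.
by exists r; split=> //; exact: mt_le_trans rrho rho_le.
Qed.

Section RealName.
Variable c : rname theta.
Hypothesis hc : real_name P c.

Definition decides tau (s : seq bool) : Prop :=
  forall n, n < size s ->
    exists2 sigma, c (n, nth false s n) sigma & mt_le tau sigma.

Lemma decides_le sigma tau s : mt_le sigma tau -> decides tau s ->
  decides sigma s.
Proof.
by move=> st ts n /ts[rho crho tr]; exists rho => //; exact: mt_le_trans st tr.
Qed.

Lemma decides_forces_initial tau s : decides tau s -> forces_initial tau c s.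
Proof.
move=> tau_s n /tau_s[sigma c_sigma tau_sigma]; exists [set sigma].
split; [exact: finite_set1|by move=> _ ->|].
by move=> x /(mt_body_le tau_sigma) x_sigma; exists sigma.
Qed.

Lemma decides_exists tau l : MT P tau ->
  exists sigma s,
    [/\ MT P sigma, mt_le sigma tau, size s = l & decides sigma s].
Proof.
move=> tauP; elim: l => [|l [sigma [s [sP st sl sd]]]];
  first by exists tau, [::].
have [_ /(_ l sigma sP)[rho c_rho [r [rP r_rho rs]]] _] := hc.
have [i ci] : exists i, c (l, i) rho by case: c_rho; [exists false|exists true].
exists r, (rcons s i); split=> //; first exact: mt_le_trans rs st.
  by rewrite size_rcons sl.
move=> n; rewrite size_rcons ltnS leq_eqVlt nth_rcons => /orP[/eqP ->|ns].
  by rewrite ltnn eqxx sl; exists rho.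
by rewrite ns; exact: decides_le rs sd _ ns.
Qed.

Lemma decides_agree tau s n i : MT P tau -> decides tau s -> n < size s ->
  forces_value tau c n i -> nth false s n = i.
Proof.
move=> tauP tau_s ns [S [fS Sc tS]]; have [cP _ c_incomp] := hc.
have [sigma c_sigma tau_sigma] := tau_s n ns.
have [|rho Srho [r [rP r_rho r_tau]]] := compatible_of_cover fS _ tauP tS.
  by move=> x /Sc/cP.
have r_sigma := mt_le_trans r_tau tau_sigma; have c_rho := Sc _ Srho.
case: i (nth false s n) c_sigma c_rho {Sc} => -[] // c_sigma c_rho; exfalso.
  by apply: (c_incomp _ _ _ c_sigma c_rho); exists r.
by apply: (c_incomp _ _ _ c_rho c_sigma); exists r.
Qed.

Lemma decides_prefix tau s t :
  MT P tau -> decides tau s -> forces_initial tau c t -> size t <= size s ->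
  prefix t s.
Proof.
move=> tauP tau_s tau_t ts; apply/(prefix_nth false) => n nt.
have ns := leq_trans nt ts; split=> //.
exact: decides_agree tauP tau_s ns (tau_t n nt).
Qed.

Lemma forces_neq_avoids tau q : forces_neq tau c (pi_name q) ->
  exists l, forall sigma s, MT P sigma -> mt_le sigma tau -> decides sigma s ->
    l <= size s -> ~ sigma q s.
Proof.
move=> [s [t [st tau_s tau_t]]]; exists (size t)
  => sigma u sP s_tau s_u tu sigma_u.
have [x xs xu] := mt_body_through sP sigma_u.
have tu' : prefix t u.
  exact: decides_prefix sP s_u (forces_initial_le s_tau tau_t) tu.
have xsE := forces_initial_pi tau_s (mt_body_le s_tau xs); apply: st.
have x_prefix m n : m <= n -> prefix (mkseq (x q) m) (mkseq (x q) n).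
  by move=> mn; rewrite /mkseq -(subnKC mn) iotaD map_cat prefix_prefix.
apply: (@prefix_comparable _ _ (mkseq (x q) (size s + size u))).
  by rewrite -{1}xsE x_prefix // leq_addr.
by apply: prefix_trans tu' _; rewrite -{1}xu x_prefix // leq_addl.
Qed.

Variable eta : below theta.
Hypothesis hD : forall k : nat, mt_dense P
  [set tau | MT P tau /\ forces_neq tau c (pi_name (eta, k))].

Lemma forces_neq_finite (K : set nat) : finite_set K -> forall tau, MT P tau ->
  exists2 sigma, MT P sigma /\ mt_le sigma tau &
    forall k, K k -> forces_neq sigma c (pi_name (eta, k)).
Proof.
move: K; apply: finite_set_ind => [tau tauP|K k _ IH tau tauP];
  first by exists tau.
have [_ /(_ tau tauP)[sigma [sP sk] st]] := hD k.
have [r [rP rs] rK] := IH _ sP; exists r.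
  by split=> //; exact: mt_le_trans rs st.
by move=> l [->|/rK //]; exact: forces_neq_le sk.
Qed.

Lemma decides_avoiding_finite (K : set nat) tau : finite_set K -> MT P tau ->
  exists sigma s, [/\ MT P sigma, mt_le sigma tau, decides sigma s &
    forall k, K k -> ~ sigma (eta, k) s].
Proof.
move=> fK tauP.
have [tau' [tau'P tau'_tau] tau'_neq] := forces_neq_finite fK tauP.
have /choice[len lenP] k : exists l, K k -> forall sigma s,
    MT P sigma -> mt_le sigma tau' -> decides sigma s -> l <= size s ->
      ~ sigma (eta, k) s.
  have [/tau'_neq/forces_neq_avoids[l lP]|nK] := pselect (K k);
    first by exists l.
  by exists 0.
have [l lP] := finite_set_bound len fK.
have [sigma [s [sP s_le sl sd]]] := decides_exists l tau'P.
exists sigma, s; split=> // [|k Kk]; first exact: mt_le_trans s_le tau'_tau.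
by apply: (lenP k Kk) => //; rewrite sl; exact/ltnW/lP.
Qed.

Lemma forces_neq_pi_nonempty : P eta !=set0.
Proof.
have [_ /(_ _ MT_setT)[tau [tauP [s [t [st tau_s _]]]] _]] := hD 0.
have [/(_ (eta, 0))[Ptau|tauT] _] := tauP; first by exists (tau (eta, 0)).
case: s st tau_s => [|i s] st tau_s; first by case: st; left; exact: prefix0s.
have [|x x_tau] := mt_body_through (p := (eta, 0)) (u := [:: ~~ i]) tauP;
  first by rewrite tauT.
have := forces_initial_pi tau_s x_tau; rewrite /mkseq /= => -[-> _].
by case: (i).
Qed.

End RealName.
End Conditions.
End Multitrees.

(** * Extending multisystems *)

Definition height (phi : system) (n : nat) : Prop :=
  forall s, isSome (phi s) = (size s < n).

Definition half (T : tree) (i : bool) : tree :=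
  restrict_tree T (rcons (stem T) i).

Section Systems.
Variable Q : set tree.
Hypothesis hQ : ptforcing Q.

Lemma stem_sub T T' : Q T -> Q T' -> T' `<=` T -> prefix (stem T) (stem T').
Proof.
move=> /(proj1 hQ)/perfect_tree_stem[[T_comp _] _].
by move=> /(proj1 hQ)/perfect_tree_stem[[_ T'_max] _] TT';
  apply: T'_max => t /TT'/T_comp.
Qed.

Lemma half_in T i : Q T -> Q (half T i).
Proof.
by move=> QT; apply: (proj2 hQ) => //;
  have [_] := perfect_tree_stem (proj1 hQ _ QT).
Qed.

Lemma stem_half T i : Q T -> prefix (rcons (stem T) i) (stem (half T i)).
Proof.
move=> /(half_in i)/(proj1 hQ)/perfect_tree_stem[[_ half_max] _].
by apply: half_max => t [].
Qed.

Definition next_node (T0 : tree) (phi : system) (s : seq bool) : tree :=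
  if s is [::] then T0
  else half (odflt T0 (phi (take (size s).-1 s))) (last false s).

Lemma next_node_rcons T0 phi s i :
  next_node T0 phi (rcons s i) = half (odflt T0 (phi s)) i.
Proof.
rewrite /next_node; case e : (rcons s i) => [|x t]; first by case: (s) e.
by rewrite -e size_rcons last_rcons -cats1 take_size_cat.
Qed.

Lemma splitting_extendS phi n :
  splitting_system Q phi -> height phi n -> Q !=set0 ->
  exists psi, [/\ splitting_system Q psi, height psi n.+1 & system_le phi psi].
Proof.
move=> [_ phiQ phi_split] phi_n [T0 QT0].
pose psi s := if size s == n then Some (next_node T0 phi s) else phi s.
have psi_lt s : size s < n -> psi s = phi s by rewrite /psi; case: ltngtP.
have psi_n : height psi n.+1.
  by move=> s; rewrite ltnS leq_eqVlt /psi; case: eqP => //= _; exact: phi_n.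
exists psi; split=> //; last first.
  by move=> s T phis; rewrite psi_lt // -phi_n phis.
split; first by exists n.+1.
  move=> s T; rewrite /psi; case: eqP => [_ [<-]|_]; last exact: phiQ.
  case/lastP: s => [//|s i]; rewrite next_node_rcons; apply: half_in.
  by case phis : (phi s) => [T'|//]; exact: phiQ phis.
move=> s i T T' psis psisi.
have sn : size s < n.
  by have := psi_n (rcons s i); rewrite psisi size_rcons ltnS.
rewrite psi_lt // in psis; move: psisi; rewrite /psi.
case: eqP => [_ [<-]|_]; last exact: phi_split.
rewrite next_node_rcons psis; split; first exact: subIsetl.
exact: stem_half (phiQ _ _ psis).
Qed.

Lemma splitting_extend phi m n : splitting_system Q phi -> height phi m ->
  Q !=set0 -> m <= n ->
  exists psi, [/\ splitting_system Q psi, height psi n & system_le phi psi].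
Proof.
move=> phiS phi_m Q0 /subnKC <-.
elim: (n - m) => [|k [psi [psiS psi_n phi_psi]]].
  by rewrite addn0; exists phi; split.
have [chi [chiS chi_n psi_chi]] := splitting_extendS psiS psi_n Q0.
by rewrite addnS; exists chi; split=> // s T /phi_psi; exact: psi_chi.
Qed.

Lemma splitting_prune phi (g : seq bool -> tree -> tree) :
  splitting_system Q phi ->
  (forall t T, phi t = Some T -> g t T = T \/
     [/\ Q (g t T), g t T `<=` T & forall i, phi (rcons t i) = None]) ->
  splitting_system Q (fun t => omap (g t) (phi t)).
Proof.
move=> [[n phi_n] phiQ phi_split] gP; split.
- by exists n => s; rewrite -phi_n; case: (phi s).
- move=> s T; case phis : (phi s) => [T'|//] [<-].
  by case: (gP _ _ phis) => [->|[]] //; exact: phiQ phis.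
move=> s i T T'; case phis : (phi s) => [W|//] [<-].
case phisi : (phi (rcons s i)) => [W'|//] [<-].
have -> : g s W = W by case: (gP _ _ phis) => // -[_ _ /(_ i)]; rewrite phisi.
have [WW' stemW] := phi_split _ _ _ _ phis phisi.
case: (gP _ _ phisi) => [-> //|[QgW gW _]]; split;
  first exact: subset_trans gW WW'.
by apply: prefix_trans stemW (stem_sub _ QgW gW); exact: phiQ phisi.
Qed.

Definition root_system (T : tree) : system :=
  fun s => if s is [::] then Some T else None.

Lemma splitting_root T : Q T -> splitting_system Q (root_system T).
Proof.
move=> QT; split; first by exists 1 => -[].
  by move=> [|i s] T' //= [<-].
by move=> [|i s].
Qed.

Lemma splitting_empty : splitting_system Q (fun _ => None).
Proof. by split=> //; exists 0. Qed.

End Systems.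

Section Multisystems.
Variables (theta : V) (P : below theta -> set tree).
Hypothesis hP : forall xi, ptforcing (P xi).
Implicit Types Phi Psi : multisystem theta.

Lemma MS_height_bound Psi : MS P Psi ->
  exists n, forall q s, isSome (Psi q s) -> size s < n.
Proof.
move=> [PsiS Psi_fin].
have /choice[ht htE] q : exists n, height (Psi q) n.
  by have [[n]] := PsiS q; exists n.
have [n nP] := finite_set_bound ht Psi_fin; exists n => q s qs.
by rewrite (leq_trans _ (ltnW (nP q _))) -?htE //; exists s.
Qed.

Lemma MS_extend Psi (K : set (Defs.index theta)) n : MS P Psi ->
  finite_set K -> (forall q, K q -> P q.1 !=set0) ->
  (forall q s, isSome (Psi q s) -> size s < n) ->
  exists2 Phi, MS P Phi /\ ms_le Psi Phi & forall q, K q -> height (Phi q) n.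
Proof.
move=> [PsiS Psi_fin] K_fin K_ne Psi_n.
have /choice[Phi PhiP] q : exists phi, [/\ splitting_system (P q.1) phi,
    system_le (Psi q) phi, K q -> height phi n & ~ K q -> phi = Psi q].
  have [Kq|nK] := pselect (K q); last by exists (Psi q); split.
  have [[m Psi_q_m] _ _] := PsiS q.
  have mn : m <= n.
    rewrite leqNgt; apply/negP => nm; have := Psi_n q (nseq n false).
    by rewrite Psi_q_m size_nseq ltnn => /(_ nm).
  by have [phi []] := splitting_extend (hP q.1) (PsiS q) Psi_q_m (K_ne q Kq) mn;
    exists phi.
exists Phi; last by move=> q; have [_ _ + _] := PhiP q.
split; last by move=> q; have [] := PhiP q.
split=> [q|]; first by have [] := PhiP q.
apply: (@sub_finite_set _ _ (K `|` [set q | exists s, isSome (Psi q s)])).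
  move=> q [s]; have [Kq|nK] := pselect (K q); [by left|right; exists s].
  by have [_ _ _ <-] := PhiP q.
by rewrite finite_setU.
Qed.

Lemma MS_prune Phi (a : Defs.index theta -> option (nat * seq bool))
  (tau : multitree theta) :
  MS P Phi ->
  (forall p q x, p.1 = q.1 -> a p = Some x -> a q = Some x -> p = q) ->
  (forall p m t, a p = Some (m, t) -> exists2 T, Phi (p.1, m) t = Some T &
     [/\ P p.1 (tau p), tau p `<=` T
       & forall i, Phi (p.1, m) (rcons t i) = None]) ->
  exists Phi', [/\ MS P Phi',
    forall p m t, a p = Some (m, t) -> Phi' (p.1, m) t = Some (tau p)
  & forall q t, (forall p, p.1 = q.1 -> a p <> Some (q.2, t)) ->
      Phi' q t = Phi q t].
Proof.
move=> [PhiS Phi_fin] a_inj aP.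
have /choice[g gP] (qt : Defs.index theta * seq bool) : exists g : tree -> tree,
    (forall p, p.1 = qt.1.1 -> a p = Some (qt.1.2, qt.2) ->
      forall T, g T = tau p) /\
    ((forall p, p.1 = qt.1.1 -> a p <> Some (qt.1.2, qt.2)) ->
      forall T, g T = T).
  have [[p [p1 ap]]|nap] :=
      pselect (exists p, p.1 = qt.1.1 /\ a p = Some (qt.1.2, qt.2)).
    exists (fun _ => tau p); split=> [q q1 aq _|/(_ p p1)] //.
    by congr tau; apply: (a_inj _ _ _ _ ap aq); rewrite p1 q1.
  by exists id; split=> // p p1 ap; case: nap; exists p.
exists (fun q t => omap (g (q, t)) (Phi q t)); split.
- split=> [q|]; last first.
    by apply: sub_finite_set Phi_fin => q [s qs]; exists s; case: (Phi q s) qs.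
  apply: splitting_prune (PhiS q) _ => // t T qt.
  have [g_tau g_id] := gP (q, t).
  have [[p [p1 ap]]|nap] :=
    pselect (exists p, p.1 = q.1 /\ a p = Some (q.2, t)).
    right; rewrite (g_tau p p1 ap); have := aP _ _ _ ap.
    by rewrite p1 -surjective_pairing qt => -[_ [<-]].
  by left; apply: g_id => p p1 ap; case: nap; exists p.
- move=> p m t ap; have [T -> _] := aP _ _ _ ap.
  by have [g_tau _] := gP (p.1, m, t); rewrite /= (g_tau p).
move=> q t naq; case: (Phi q t) => [T|//] /=; congr Some.
by have [_ ->] := gP (q, t).
Qed.

Lemma MS_add_roots Phi tau : MS P Phi -> MT P tau ->
  exists2 Phi', MS P Phi' /\ ms_le Phi Phi' &
    forall p, tau p = setT \/ exists m, Phi' (p.1, m) [::] = Some (tau p).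
Proof.
move=> [PhiS Phi_fin] [tauP tau_fin].
have [mu muP] := finite_set_bound snd Phi_fin.
have Phi_mu q s : mu <= q.2 -> Phi q s = None.
  case qs : (Phi q s) => [T|//]; rewrite leqNgt muP //.
  by exists s; rewrite qs.
have /choice[root rootP] p : exists phi, [/\ splitting_system (P p.1) phi,
    (exists s, isSome (phi s)) -> Defs.support tau p
  & tau p = setT \/ phi [::] = Some (tau p)].
  have [tauT|tau_p] := pselect (tau p = setT).
    exists (fun _ => None); split; [exact: splitting_empty|by case|by left].
  exists (root_system (tau p)); split=> //; last by right.
  by apply: splitting_root; case: (tauP p).
exists (fun q => if mu <= q.2 then root (q.1, q.2 - mu) else Phi q).
  split; last by move=> q s T; case: ifP => // /Phi_mu ->.
  split=> [q|]; first by case: ifP => _ //; have [] := rootP (q.1, q.2 - mu).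
  apply: (@sub_finite_set _ _ ([set q | exists s, isSome (Phi q s)] `|`
     (fun p : Defs.index theta => (p.1, mu + p.2)) @` Defs.support tau)).
    move=> q; rewrite /=; case: ifP => [mq qs|_ qs]; [right|by left].
    exists (q.1, q.2 - mu); last by rewrite /= subnKC // -surjective_pairing.
    by have [_ + _] := rootP (q.1, q.2 - mu); apply.
  by rewrite finite_setU; split=> //; exact: finite_image.
move=> p; have [_ _ [->|root_p]] := rootP p; [by left|right].
by exists (mu + p.2); rewrite /= leq_addr addKn -surjective_pairing.
Qed.

End Multisystems.

(** * The dense set of avoiding multisystems *)

Lemma distinct_extensions (T : Type) (S : set T) (u : T -> seq bool) N :
  finite_set S ->
  exists H (t : T -> seq bool), [/\ N <= H,
    forall x, S x -> prefix (u x) (t x) /\ size (t x) = H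
  & forall x y, S x -> S y -> t x = t y -> x = y].
Proof.
move=> S_fin; have /countable_injP[g g_inj] := finite_set_countable S_fin.
have [L uL] := finite_set_bound (size \o u) S_fin.
have [G gG] := finite_set_bound g S_fin.
pose pad x := u x ++ nseq (maxn L N - size (u x)) false.
have size_pad x : S x -> size (pad x) = maxn L N.
  by move=> /uL/= ux; rewrite size_cat size_nseq subnKC // leq_max ltnW.
exists (maxn L N + G), (fun x => pad x ++ mkseq (eq_op (g x)) G); split.
- exact: leq_trans (leq_maxr _ _) (leq_addr _ _).
- move=> x Sx; rewrite size_cat size_pad // size_mkseq; split=> //.
  by rewrite -catA prefix_prefix.
move=> x y Sx Sy /eqP; rewrite eqseq_cat ?size_pad // => /andP[_ /eqP gxy].
apply: g_inj; rewrite ?inE //; have := congr1 (nth false ^~ (g x)) gxy.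
by rewrite !nth_mkseq ?gG // eqxx => /esym/eqP.
Qed.

Section Labels.
Variables (theta : V) (F : set (Defs.index theta)).
Variables (f : Defs.index theta -> nat * seq bool) (eta : below theta)
  (m0 : nat).
Hypothesis F_fin : finite_set F.

(* A coordinate of [F] is labelled by a node extending its constraint [f]; nodes
   of the level [H] of the system [(eta, m0)] that are still unused label fresh
   coordinates over [eta]. *)
Lemma level_labelling N k0 : (forall p, F p -> p.2 < k0) ->
  exists H (a : Defs.index theta -> option (nat * seq bool)),
    [/\ N <= H /\ finite_set [set p | a p <> None],
      forall p m t, a p = Some (m, t) ->
        size t = H /\ (F p \/ [/\ p.1 = eta, m = m0 & k0 <= p.2]),
      forall p q x, p.1 = q.1 -> a p = Some x -> a q = Some x -> p = q,
      forall p, F p -> exists2 t, prefix (f p).2 t & a p = Some ((f p).1, t)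
    & forall t, size t = H -> exists k, a (eta, k) = Some (m0, t)].
Proof.
move=> F_k0; have [H [t_ [NH t_ext t_inj]]] :=
  distinct_extensions (snd \o f) N F_fin.
pose used t := exists q, [/\ F q, q.1 = eta, (f q).1 = m0 & t_ q = t].
pose fresh (p : Defs.index theta) t :=
  [/\ size t = H, p = (eta, k0 + pickle t) & ~ used t].
pose label p x := F p /\ x = ((f p).1, t_ p) \/ fresh p x.2 /\ x.1 = m0.
have freshN p t : fresh p t -> ~ F p.
  by move=> [_ -> _] /F_k0; rewrite ltnNge leq_addr.
have [|a aP] := functional_option_fun (R := label).
  move=> p x y [[Fp ->]|[fx x1]] [[Fp' ->]|[fy y1]] //.
  - by case: (freshN _ _ fy).
  - by case: (freshN _ _ fx).
  rewrite [x]surjective_pairing [y]surjective_pairing x1 y1; congr pair.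
  by case: fx fy => _ -> _ [_ [/addnI/(pcan_inj pickleK) ->]].
exists H, a; split.
- split=> //; apply: (@sub_finite_set _ _ (F `|`
    (fun t => (eta, k0 + pickle t)) @` [set t | size t < H.+1])).
    move=> p /=; case ap : (a p) => [x|//] _.
    case: ((aP p x).1 ap) => [[Fp _]|[[tH pE _] _]]; [by left|right].
    by exists x.2; rewrite /= ?tH.
  by rewrite finite_setU; split=> //; apply: finite_image;
    exact: finite_seq_size_lt.
- move=> p m t /aP[[Fp [_ ->]]|[[tH -> _] /= ->]].
    by split; [case: (t_ext p Fp)|left].
  by split=> //; right; rewrite leq_addr.
- move=> p q x pq /aP[[Fp xp]|[fp x1]] /aP[[Fq xq]|[fq x1']].
  + by apply: t_inj => //; move: xq; rewrite xp => -[].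
  + case: fq => _ qE; case; exists p; split=> //; first by rewrite pq qE.
      by rewrite -x1' xp.
    by rewrite xp.
  + case: fp => _ pE; case; exists q; split=> //; first by rewrite -pq pE.
      by rewrite -x1 xq.
    by rewrite xq.
  + by case: fp fq => _ -> _ [_ ->].
- move=> p Fp; exists (t_ p); first by case: (t_ext p Fp).
  by apply/aP; left.
move=> t tH; have [[q [Fq q1 fq tq]]|nused] := pselect (used t).
  by exists q.2; rewrite -q1 -surjective_pairing; apply/aP; left; rewrite fq tq.
by exists (k0 + pickle t); apply/aP; right.
Qed.

End Labels.

Definition drawn_from theta (Phi : multisystem theta)
    (tau : multitree theta) : Prop :=
  forall p, tau p = setT \/ exists m t, Phi (p.1, m) t = Some (tau p).

Section Avoiding.
Variables (theta : V) (P : below theta -> set tree) (c : rname theta).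
Variables (eta : below theta) (m0 : nat).
Variables (F : set (Defs.index theta)) (f : Defs.index theta -> nat * seq bool).
Variable nu : multitree theta.

Definition obeys (Phi : multisystem theta) (tau : multitree theta) : Prop :=
  forall p, F p -> tau p = setT \/
    exists2 t, prefix (f p).2 t & Phi (p.1, (f p).1) t = Some (tau p).

Definition level_misses (phi : system) (s : seq bool) : Prop :=
  exists n, forall t, size t = n -> exists2 T, phi t = Some T & ~ T s.

Definition avoids (Phi : multisystem theta) : Prop :=
  exists2 s, level_misses (Phi (eta, m0)) s & exists2 tau, MT P tau &
    [/\ drawn_from Phi tau, obeys Phi tau, decides c tau s & mt_le tau nu].

Hypothesis hP : forall xi, ptforcing (P xi).
Hypotheses (hc : real_name P c) (hD : forall k : nat, mt_dense P
    [set tau | MT P tau /\ forces_neq tau c (pi_name (eta, k))]).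
Hypotheses (F_fin : finite_set F) (F_ne : forall p, F p -> P p.1 !=set0).
Hypotheses (nuP : MT P nu) (nu_F : forall p, F p -> nu p = setT).

Lemma MT_below_mem (tau sigma : multitree theta) p :
  MT P tau -> tau p `<=` sigma p -> P p.1 (sigma p) -> P p.1 (tau p).
Proof.
move=> [/(_ p)[//|tauT] _] tau_sigma Psigma.
by suff -> : tau p = sigma p by []; apply/seteqP; split=> //; rewrite tauT.
Qed.

Lemma fresh_bound : exists k0, (forall p, F p -> p.2 < k0) /\
  forall p, F p \/ k0 <= p.2 -> nu p = setT.
Proof.
have [k1 F_k1] := finite_set_bound snd F_fin.
have [k2 nu_k2] := finite_set_bound snd (proj2 nuP).
exists (maxn k1 k2); split=> [p /F_k1|p [/nu_F //|]];
  first by rewrite leq_max => ->.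
rewrite geq_max => /andP[_ k2p]; apply: contrapT => /nu_k2.
by rewrite ltnNge k2p.
Qed.

Section Labelled.
Variables (Phi : multisystem theta) (H : nat).
Variable a : Defs.index theta -> option (nat * seq bool).
Hypotheses (PhiP : MS P Phi) (a_fin : finite_set [set p | a p <> None]).
Hypotheses
  (a_inj : forall p q x, p.1 = q.1 -> a p = Some x -> a q = Some x -> p = q)
  (a_size : forall p m t, a p = Some (m, t) -> size t = H)
  (a_height : forall p m t, a p = Some (m, t) -> height (Phi (p.1, m)) H.+1)
  (a_nu : forall p, a p <> None -> nu p = setT)
  (a_level : forall t, size t = H -> exists k, a (eta, k) = Some (m0, t)).

Definition node_multitree : multitree theta := fun p =>
  if a p is Some (m, t) then odflt setT (Phi (p.1, m) t) else nu p.

Lemma node_multitreeE p m t : a p = Some (m, t) ->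
  Phi (p.1, m) t = Some (node_multitree p).
Proof.
move=> ap; rewrite /node_multitree ap; have := a_height ap t.
by rewrite (a_size ap) ltnSn; case: (Phi _ _).
Qed.

Lemma node_multitree_in p : a p <> None -> P p.1 (node_multitree p).
Proof.
case ap : (a p) => [[m t]|//] _; have [_ Phi_P _] := (proj1 PhiP) (p.1, m).
exact: Phi_P (node_multitreeE ap).
Qed.

Lemma node_multitree_le : mt_le node_multitree nu.
Proof.
move=> p; have [ap|nap] := pselect (a p = None);
  first by rewrite /node_multitree ap.
by rewrite a_nu.
Qed.

Lemma MT_node_multitree : MT P node_multitree.
Proof.
split=> [p|].
  have [ap|nap] := pselect (a p = None); last by left; exact: node_multitree_in.
  by rewrite /node_multitree ap; case: nuP.
apply: (@sub_finite_set _ _ ([set p | a p <> None] `|` Defs.support nu)).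
  by move=> p; rewrite /Defs.support /= /node_multitree; case: (a p) => [x|];
    [left|right].
by rewrite finite_setU; split=> //; case: nuP.
Qed.

Lemma avoids_labelled : exists Phi' s tau,
  [/\ MS P Phi' /\
        (forall q t T, size t < H -> Phi q t = Some T -> Phi' q t = Some T),
    level_misses (Phi' (eta, m0)) s, MT P tau,
    [/\ drawn_from Phi' tau, decides c tau s & mt_le tau nu]
  & forall p m t, a p = Some (m, t) -> Phi' (p.1, m) t = Some (tau p)].
Proof.
have K_fin : finite_set [set k | a (eta, k) <> None].
  apply: (@sub_finite_set _ _ (snd @` [set p | a p <> None]));
    last exact: finite_image.
  by move=> k ak; exists (eta, k).
have [tau [s [tauP tau_le tau_s tau_avoids]]] :=
  decides_avoiding_finite hP hc hD K_fin MT_node_multitree.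
have [|Psi [PsiP Psi_a Psi_Phi]] := MS_prune hP PhiP a_inj (tau := tau).
  move=> p m t ap; exists (node_multitree p); first exact: node_multitreeE.
  split=> [||i]; last 1 first.
  - have := a_height ap (rcons t i); rewrite size_rcons (a_size ap) ltnn.
    by case: (Phi _ _).
  - by apply: MT_below_mem tauP (tau_le p) _; apply: node_multitree_in;
      rewrite ap.
  - exact: tau_le.
have [Phi' [Phi'P Psi_Phi'] Phi'_roots] := MS_add_roots PsiP tauP.
exists Phi', s, tau; split=> //.
- split=> // q t T tH qt; apply: Psi_Phi'; rewrite Psi_Phi // => p _ /a_size tE.
  by rewrite tE ltnn in tH.
- exists H => t tH; have [k ak] := a_level tH; exists (tau (eta, k)).
    exact/Psi_Phi'/(Psi_a (eta, k)).
  by apply: tau_avoids; rewrite /= ak.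
- split=> //; last exact: mt_le_trans tau_le node_multitree_le.
  by move=> p; case: (Phi'_roots p) => [->|[m pm]];
    [left|right; exists m, [::]].
by move=> p m t /Psi_a/Psi_Phi'.
Qed.

End Labelled.

Lemma avoids_dense Psi : MS P Psi ->
  exists2 Phi, MS P Phi /\ avoids Phi & ms_le Psi Phi.
Proof.
move=> PsiP; have [N PsiN] := MS_height_bound PsiP.
have [k0 [F_k0 nu_k0]] := fresh_bound.
have [H [a [[NH a_fin] aP a_inj a_F a_level]]] :=
  level_labelling f eta m0 F_fin N F_k0.
pose K : set (Defs.index theta) :=
  [set q | exists p t, p.1 = q.1 /\ a p = Some (q.2, t)].
have K_fin : finite_set K.
  apply: (@sub_finite_set _ _ ((fun p : Defs.index theta =>
    (p.1, (odflt (0, [::]) (a p)).1)) @` [set p | a p <> None]));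
      last exact: finite_image.
  by move=> q [p [t [pq ap]]]; exists p;
    rewrite /= ap // pq -surjective_pairing.
have K_ne q : K q -> P q.1 !=set0.
  move=> [p [t [<- /aP[_ [/F_ne //|[-> _ _]]]]]].
  exact: (forces_neq_pi_nonempty hP hD).
have [|Phi [PhiP Psi_Phi] Phi_K] := MS_extend hP (n := H.+1) PsiP K_fin K_ne.
  by move=> q s /PsiN sN; exact: leq_trans (leq_trans sN NH) (leqnSn _).
have [|||Phi'
  [s [tau [[Phi'P Phi_Phi'] Phi'_s tauP [drawn tau_s tau_nu] Phi'_a]]]] :=
    avoids_labelled PhiP a_fin a_inj (H := H) _ _ _ a_level.
- by move=> p m t /aP[].
- by move=> p m t ap; apply: Phi_K; exists p, t.
- move=> p; case ap : (a p) => [[m t]|//] _; apply: nu_k0.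
  by have [_ [|[]]] := aP _ _ _ ap; [left|right].
exists Phi'.
  split=> //; exists s => //; exists tau => //; split=> // p Fp; right.
  by have [t t_ext ap] := a_F p Fp; exists t => //; exact: Phi'_a.
move=> q t T qt; apply: Phi_Phi' (Psi_Phi _ _ _ qt).
by apply: leq_trans (PsiN q t _) NH; rewrite qt.
Qed.

End Avoiding.

(** * The dense set belongs to the model *)

Definition vnode (phi u T : V) : Prop := vmem u (vdom phi) /\ vapp phi u = T.

Lemma vnodeP phi t T :
  vnode (code_system phi) (code_string t) (code_tree T) <-> phi t = Some T.
Proof.
rewrite /vnode mem_vdom_code_system; split=> [|phit]; last first.
  by rewrite phit; split=> //; exact: vapp_code_system.
case phit : (phi t) => [T'|] [//] _; rewrite (vapp_code_system phit).
by move=> /code_tree_inj ->.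
Qed.

Section AvoidingCodes.
Variables (theta : V) (P : below theta -> set tree) (c : rname theta).
Variables (eta : below theta) (m0 : nat).
Variables (F : set (Defs.index theta)) (f : Defs.index theta -> nat * seq bool).
Variable nu : multitree theta.

Definition vdrawn_from (z t : V) : Prop :=
  forall xi, vmem xi theta -> forall k, vmem k vomega ->
    vapp t (opair xi k) = vstrings \/
    exists2 m, vmem m vomega & exists2 u, vmem u vstrings &
      vnode (vapp z (opair xi m)) u (vapp t (opair xi k)).

Definition vobeys (z t : V) : Prop :=
  forall p, F p -> vapp t (code_index p) = vstrings \/
    exists2 u, vmem u vstrings & vsub (code_string (f p).2) u /\
      vnode (vapp z (code_index (p.1, (f p).1))) u (vapp t (code_index p)).

Definition vdecides (t s : V) : Prop :=
  forall n, vmem n vomega -> forall i, vmem i (vnat 2) -> vmem (opair n i) s ->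
    exists2 sigma, vmem sigma (vapp (code_rname c) (opair n i)) &
      forall p, vmem p (vindex theta) -> vsub (vapp t p) (vapp sigma p).

Definition vbelow (t : V) : Prop :=
  forall p, Defs.support nu p ->
    vsub (vapp t (code_index p)) (code_tree (nu p)).

Definition vlevel_misses (phi s : V) : Prop :=
  exists2 n, vmem n vomega & forall u, vmem u vstrings -> vdom u = n ->
    vmem u (vdom phi) /\ ~ vmem s (vapp phi u).

Definition vavoids (z : V) : Prop :=
  exists2 s, vmem s vstrings
    & vlevel_misses (vapp z (code_index (eta, m0))) s /\
  exists2 t, vmem t (code_set (@code_multitree theta) (MT P)) &
    vdrawn_from z t /\ vobeys z t /\ vdecides t s /\ vbelow t.

Section Definability.
Variables (M : set V) (hM : countable_transitive_model M).
Hypotheses (Mtheta : M theta) (MP : M (code_family P)) (Mc : M (code_rname c)).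
Hypotheses (F_fin : finite_set F) (nuP : MT P nu).

Lemma definable_vavoids : definable M (fun e => vavoids (e 0)).
Proof.
have Momega := model_vomega hM; have Mstrings := model_vstrings hM.
have Mindex := model_vindex hM Mtheta.
have MMT := model_multitrees hM Mtheta MP.
have M2 := model_vnat hM 2; have Mcode_index p := model_code_index hM Mtheta p.
have Mcode_string s := model_code_string hM s.
have M_nu p : Defs.support nu p -> M (code_tree (nu p)).
  by move=> nu_p; apply: (model_code_tree hM Mtheta MP (xi := p.1));
    case: nuP => /(_ p)[].
rewrite /vavoids /vlevel_misses /vdrawn_from /vdecides /vnode.
have dobeys : definable M (fun e => vobeys (e 2) (e 0)).
  by apply: definable_finite_all => // p _; rewrite /vnode; definability.
have dbelow : definable M (fun e => vbelow (e 0)).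
  by apply: definable_finite_all (proj2 nuP) _ => p /M_nu Mnu_p; definability.
by definability.
Qed.

End Definability.

Variable Phi : multisystem theta.

Let opair_index (xi : V) (xitheta : vmem xi theta) k :
  opair xi (vnat k) = @code_index theta (exist _ xi xitheta, k).
Proof. by []. Qed.

Lemma vdrawn_fromP (tau : multitree theta) :
  vdrawn_from (code_multisystem Phi) (code_multitree tau) <->
    drawn_from Phi tau.
Proof.
split=> [drawn p|drawn xi xitheta _ /vmem_vomega[k ->]].
  case: (drawn _ (proj2_sig p.1) _ (in_vomega p.2));
    rewrite (vapp_code_multitree tau p).
    by move=> /code_tree_inj; left.
  move=> [_ /vmem_vomega[m ->] [_ /vmem_vstrings[t ->]]].
  by rewrite (vapp_code_multisystem Phi (p.1, m)) => /vnodeP; right;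
    exists m, t.
rewrite (opair_index xitheta) vapp_code_multitree.
have [->|[m [t pt]]] := drawn (exist _ xi xitheta, k); [by left|right].
exists (vnat m); first exact: in_vomega.
exists (code_string t); first exact: in_vstrings.
by rewrite opair_index vapp_code_multisystem; exact/vnodeP.
Qed.

Lemma vobeysP (tau : multitree theta) :
  vobeys (code_multisystem Phi) (code_multitree tau) <-> obeys F f Phi tau.
Proof.
split=> obey p Fp; have := obey p Fp;
  rewrite vapp_code_multitree vapp_code_multisystem.
  case=> [/code_tree_inj|[_ /vmem_vstrings[t ->]]]; first by left.
  by move=> [/vsub_code_string pt /vnodeP]; right; exists t.
case=> [->|[t pt node_t]]; [by left|right]; exists (code_string t);
  first exact: in_vstrings.
by split; [exact/vsub_code_string|exact/vnodeP].
Qed.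

Lemma vdecidesP (tau : multitree theta) s :
  vdecides (code_multitree tau) (code_string s) <-> decides c tau s.
Proof.
have leP sigma : (forall p, vmem p (vindex theta) ->
    vsub (vapp (code_multitree tau) p) (vapp (code_multitree sigma) p)) <->
      mt_le tau sigma.
  split=> [tau_sigma p|tau_sigma _ /vmem_vindex[p ->]]; last first.
    by rewrite !vapp_code_multitree; exact/vsub_code_tree.
  have := tau_sigma _ (in_vindex p).
  by rewrite !vapp_code_multitree => /vsub_code_tree.
split=> [tau_s n ns|
  tau_s _ /vmem_vomega[n ->] _ /vmem_vbool[i ->] /mem_code_string[ns si]].
  have [|||sigma] := tau_s (vnat n) _ (vnat (nth false s n)).
  - exact: in_vomega.
  - by apply/vmem_vbool; exists (nth false s n).
  - exact/mem_code_string.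
  rewrite vapp_code_rname vmem_code_set // => -[tau' c_tau' ->] /leP.
  by exists tau'.
have [sigma c_sigma tau_sigma] := tau_s n ns; rewrite si in c_sigma.
exists (code_multitree sigma); last exact/leP.
by rewrite vapp_code_rname; apply/vmem_code_set => //; exists sigma.
Qed.

Lemma vbelowP (tau : multitree theta) :
  vbelow (code_multitree tau) <-> mt_le tau nu.
Proof.
split=> [tau_nu p|tau_nu p nu_p]; last first.
  by rewrite vapp_code_multitree; exact/vsub_code_tree.
have [->//|nu_p] := pselect (nu p = setT).
by have := tau_nu p nu_p; rewrite vapp_code_multitree => /vsub_code_tree.
Qed.

Lemma vlevel_missesP phi s :
  vlevel_misses (code_system phi) (code_string s) <-> level_misses phi s.
Proof.
split=> [[_ /vmem_vomega[n ->] n_misses]|[n n_misses]].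
  exists n => t tn.
  have [||] := n_misses (code_string t); first exact: in_vstrings.
    by rewrite vdom_code_string tn.
  rewrite mem_vdom_code_system; case phit : (phi t) => [T|//] _.
  by rewrite (vapp_code_system phit) => sT; exists T => // /mem_code_tree.
exists (vnat n); first exact: in_vomega.
move=> _ /vmem_vstrings[t ->];
  rewrite vdom_code_string => /vnat_inj/n_misses[T phit Ts].
by rewrite mem_vdom_code_system (vapp_code_system phit) phit mem_code_tree.
Qed.

Lemma vavoidsP :
  vavoids (code_multisystem Phi) <-> avoids P c eta m0 F f nu Phi.
Proof.
rewrite /vavoids vapp_code_multisystem; split.
  move=> [_ /vmem_vstrings[s ->] [/vlevel_missesP s_out [t]]].
  rewrite vmem_code_set // => -[tau tauP ->].
  move=> [/vdrawn_fromP drawn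
    [/vobeysP obey [/vdecidesP tau_s /vbelowP tau_nu]]].
  by exists s => //; exists tau.
move=> [s s_out [tau tauP [drawn obey tau_s tau_nu]]].
exists (code_string s); first exact: in_vstrings.
split; first exact/vlevel_missesP.
exists (code_multitree tau); first by apply/vmem_code_set => //; exists tau.
by rewrite vdrawn_fromP vobeysP vdecidesP vbelowP.
Qed.

End AvoidingCodes.

(** * Fusion trees *)

Section Fusion.
Variables (theta : V) (P : below theta -> set tree)
  (Phi : nat -> multisystem theta).
Hypotheses (PhiP : forall j, MS P (Phi j))
  (Phi_le : forall j, ms_le (Phi j) (Phi j.+1)).

Lemma ms_le_sequence i j : i <= j -> ms_le (Phi i) (Phi j).
Proof.
move=> /subnKC <-; elim: (j - i) => [|k IH]; first by rewrite addn0 => p s T.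
by rewrite addnS => p s T /IH; exact: Phi_le.
Qed.

Lemma limit_treeE j p s T : Phi j p s = Some T -> limit_tree Phi p s = T.
Proof.
move=> ps; apply/seteqP; split=> [x [T' [i ps'] xT']|x xT]; last first.
  by exists T => //; exists j.
suff -> : T = T' by [].
by case: (leqP i j) => [ij|/ltnW ij];
  [have := ms_le_sequence ij ps'; rewrite ps
  |have := ms_le_sequence ij ps; rewrite ps'] => -[].
Qed.

Lemma limit_tree_rcons p s i :
  limit_tree Phi p (rcons s i) `<=` limit_tree Phi p s.
Proof.
move=> x [T [j psi] xT]; have [[n Phi_n] _ split_le] := (PhiP j).1 p.
have : isSome (Phi j p s) by rewrite Phi_n ltnW // -(size_rcons s i) -Phi_n psi.
case ps : (Phi j p s) => [T'|//] _; exists T'; first by exists j.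
by have [TT' _] := split_le _ _ _ _ ps psi; exact: TT'.
Qed.

Lemma limit_tree_prefix p s t : prefix s t ->
  limit_tree Phi p t `<=` limit_tree Phi p s.
Proof.
move=> /prefixP[u ->]; elim/last_ind: u => [|u i IH]; first by rewrite cats0.
by rewrite -rcons_cat; exact: subset_trans (@limit_tree_rcons _ _ _) IH.
Qed.

Lemma fusion_tree_limit p s : fusion_tree Phi p s `<=` limit_tree Phi p s.
Proof. by move=> x /(_ (size s) (leqnn _))[t [ts /prefix_size_eq ->]]. Qed.

Lemma fusion_tree_node j p s T : Phi j p s = Some T ->
  fusion_tree Phi p s `<=` T.
Proof. by move=> /limit_treeE <-; exact: fusion_tree_limit. Qed.

Lemma fusion_tree_prefix p s t : prefix s t ->
  fusion_tree Phi p t `<=` fusion_tree Phi p s.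
Proof.
move=> st x xt n /= sn; case: (leqP (size t) n) => tn.
  by have [u [us tu] xu] := xt n tn; exists u => //; split=> //;
    exact: prefix_trans tu.
exists (take n t);
  last exact: limit_tree_prefix (prefix_take _ _) _ (fusion_tree_limit xt).
split; first by rewrite size_takel // ltnW.
apply: comparable_prefix; last by rewrite size_takel // ltnW.
exact: prefix_comparable st (prefix_take _ _).
Qed.

Lemma fusion_tree_misses j p s u :
  level_misses (Phi j p) s -> ~ fusion_tree Phi p u s.
Proof.
move=> [n n_misses] /(fusion_tree_prefix (prefix0s _))/(_ n (leq0n _))[t
  [/n_misses[T pt Ts] _]].
by rewrite (limit_treeE pt).
Qed.

Section Refinement.
Variables (j : nat) (tau nu : multitree theta).
Variables (F : set (Defs.index theta)) (f : Defs.index theta -> nat * seq bool).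
Hypotheses (tauP : MT P tau) (tau_drawn : drawn_from (Phi j) tau).
Hypotheses (tau_obeys : obeys F f (Phi j) tau)
  (nu_fin : finite_set (Defs.support nu)).
Hypothesis nu_fused : forall p, tau p = setT ->
  fusion_family Phi p.1 (nu p) \/ nu p = setT.

(* Each node from which [tau] is drawn gives way to the fusion tree above it. *)
Lemma fusion_refinement : exists nu' : multitree theta,
  [/\ MT (fusion_family Phi) nu', mt_le nu' tau,
      forall p, tau p = setT -> nu' p = nu p
    & forall p, F p -> tau p <> setT ->
        nu' p `<=` fusion_tree Phi (p.1, (f p).1) (f p).2].
Proof.
have /choice[nu' nu'P] p : exists T, [/\ T `<=` tau p, tau p = setT -> T = nu p,
    tau p <> setT -> fusion_family Phi p.1 T
  & F p -> tau p <> setT -> T `<=` fusion_tree Phi (p.1, (f p).1) (f p).2].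
  have [tauT|tau_p] := pselect (tau p = setT).
    by exists (nu p); split=> //; rewrite tauT.
  have [Fp|nFp] := pselect (F p).
    have [//|[t ft pt]] := tau_obeys Fp;
      exists (fusion_tree Phi (p.1, (f p).1) t).
    split=> // [|_|_ _]; first exact: fusion_tree_node pt.
      by exists (f p).1, t.
    exact: fusion_tree_prefix.
  have [//|[m [t pt]]] := tau_drawn p; exists (fusion_tree Phi (p.1, m) t).
  split=> // [|_]; first exact: fusion_tree_node pt.
  by exists m, t.
exists nu'; split; [split=> [p|]|by move=> p; case: (nu'P p)..].
  have [_ nu'T nu'F _] := nu'P p; have [tauT|/nu'F] := pselect (tau p = setT);
    last by left.
  by rewrite nu'T //; exact: nu_fused.
apply: (@sub_finite_set _ _ (Defs.support tau `|` Defs.support nu)).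
  move=> p; rewrite /Defs.support /=; have [_ nu'T _ _] := nu'P p.
  by have [/nu'T ->|tau_p] := pselect (tau p = setT); [right|left].
by rewrite finite_setU; split=> //; case: tauP.
Qed.

End Refinement.

Variable nu : multitree theta.
Hypothesis nuP : MT (family_join P (fusion_family Phi)) nu.

Definition ground_part : multitree theta :=
  fun p => if pselect (P p.1 (nu p)) then nu p else setT.

Definition fused_support : set (Defs.index theta) :=
  [set p | [/\ Defs.support nu p, ~ P p.1 (nu p) & P p.1 !=set0]].

Lemma ground_part_in p : P p.1 (nu p) -> ground_part p = nu p.
Proof. by rewrite /ground_part; case: pselect. Qed.

Lemma ground_part_fused p : fused_support p -> ground_part p = setT.
Proof. by rewrite /ground_part => -[_ nP _]; case: pselect. Qed.

Lemma MT_ground_part : MT P ground_part.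
Proof.
split=> [p|].
  by rewrite /ground_part; case: pselect => ? /=; [left|right].
apply: sub_finite_set (proj2 nuP) => p; rewrite /Defs.support /= /ground_part.
by case: pselect.
Qed.

Lemma finite_fused_support : finite_set fused_support.
Proof. by apply: sub_finite_set (proj2 nuP) => p []. Qed.

Lemma fused_support_nodes : exists f : Defs.index theta -> nat * seq bool,
  forall p, fused_support p -> nu p = fusion_tree Phi (p.1, (f p).1) (f p).2.
Proof.
have /choice[f nu_f] p : exists ms : nat * seq bool,
    fused_support p -> nu p = fusion_tree Phi (p.1, ms.1) ms.2.
  have [[nu_p nP _]|nfused] := pselect (fused_support p);
    last by exists (0, [::]).
  by case: nuP => /(_ p)[[//|[m [s nuE]]]|//] _; exists (m, s).
by exists f; exact: nu_f.
Qed.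

Lemma fusion_refinement_below j tau f : MT P tau -> drawn_from (Phi j) tau ->
  obeys fused_support f (Phi j) tau -> mt_le tau ground_part ->
  (forall p, fused_support p ->
    nu p = fusion_tree Phi (p.1, (f p).1) (f p).2) ->
  exists nu', [/\ MT (fusion_family Phi) nu', mt_le nu' tau & mt_le nu' nu].
Proof.
move=> tauP drawn obey tau_ground fP.
have nP p : tau p = setT -> P p.1 (nu p) -> nu p = setT.
  move=> tauT Pnu; apply/seteqP; split=> // x _; rewrite -(ground_part_in Pnu).
  by apply: tau_ground; rewrite tauT.
have [|nu' [nu'P nu'_tau nu'_nu nu'_fused]] :=
    fusion_refinement tauP drawn obey (proj2 nuP).
  by move=> p tauT; case: nuP => /(_ p)[[/(nP p tauT)|]|] //;
    [right|left|right].
exists nu'; split=> // p.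
have [/nu'_nu -> //|tau_p] := pselect (tau p = setT).
have [/ground_part_in <-|nPnu] := pselect (P p.1 (nu p)).
  exact: subset_trans (nu'_tau p) (tau_ground p).
have [-> //|nu_p] := pselect (nu p = setT).
have fused_p : fused_support p.
  by split=> //; exists (tau p); case: tauP => /(_ p)[].
by rewrite fP //; exact: nu'_fused.
Qed.

End Fusion.

Lemma generic_avoids (M : set V) (theta : V) (P : below theta -> set tree) Phi
    (eta : below theta) (c : rname theta) F f nu m0 :
  countable_transitive_model M -> M theta ->
  M (code_family P) -> M (code_rname c) ->
  (forall xi, ptforcing (P xi)) -> generic_sequence M P Phi -> real_name P c ->
  (forall k, mt_dense P
    [set tau | MT P tau /\ forces_neq tau c (pi_name (eta, k))]) ->
  finite_set F -> (forall p, F p -> P p.1 !=set0) ->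
  (forall p, F p -> nu p = setT) ->
  MT P nu -> exists j, avoids P c eta m0 F f nu (Phi j).
Proof.
move=> hM Mtheta MP Mc hP [_ _ Phi_gen] hc hD F_fin F_ne nu_F nuP.
have [||j [_ /vavoidsP]] := Phi_gen [set Psi | MS P Psi /\
    vavoids P c eta m0 F f nu (code_multisystem Psi)]; last by exists j.
  split=> [Psi []//|Psi PsiP].
  have [Chi [ChiP ChiA] Psi_Chi] :=
    avoids_dense m0 f hP hc hD F_fin F_ne nuP nu_F PsiP.
  by exists Chi => //; split=> //; exact/vavoidsP.
apply: (model_definable_multisystems hM Mtheta MP hP).
exact: definable_vavoids.
Qed.

Theorem theorem5p3
  (M : set V) (hM : countable_transitive_model M)
  (theta : V) (htheta : lt_omega1_in M theta)
  (P : below theta -> set tree)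
  (hPM : M (code_family P))
  (hP : forall xi, ptforcing (P xi))
  (hPcount : forall xi, countable_in M (code_set code_tree (P xi)))
  (Phi : nat -> multisystem theta)
  (hPhi : generic_sequence M P Phi)
  (eta : below theta)
  (c : rname theta)
  (hcM : M (code_rname c))
  (hc : real_name P c)
  (hD : forall k : nat,
      mt_dense P
        [set tau | MT P tau /\ forces_neq tau c (pi_name (eta, k))])
  (nu : multitree theta)
  (hnu : MT (family_join P (fusion_family Phi)) nu)
  (U : tree) (hU : fusion_family Phi eta U) :
  exists nu' : multitree theta,
    [/\ MT (fusion_family Phi) nu', mt_le nu' nu & forces_notin nu' c U].
Proof.
have [Mtheta _ _] := htheta; have [PhiP Phi_le _] := hPhi.
have [m0 [u0 ->]] := hU; have [f nu_f] := fused_support_nodes hnu.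
have [||j [s s_out [tau tauP [drawn obey tau_s tau_nu]]]] :=
  generic_avoids f m0 hM Mtheta hPM hcM hP hPhi hc hD (finite_fused_support hnu)
    _ _ (MT_ground_part hnu).
- by move=> p [].
- exact: ground_part_fused.
have [nu' [nu'P nu'_tau nu'_nu]] :=
  fusion_refinement_below PhiP Phi_le hnu tauP drawn obey tau_nu nu_f.
exists nu'; split=> //; exists s; first exact: fusion_tree_misses s_out.
exact/decides_forces_initial/(decides_le nu'_tau).
Qed.
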